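(* Let $\mathcal{X}^n=\{X_1,\dots,X_n\}\subset\mathbb{R}^d$, $d\ge1$, be a data set in general position, with empirical measure $P_n$. Both the extended halfspace depth $\mathbf{EHD}$ and the extended zonoid depth $\mathbf{EZD}$ satisfy all four properties of a general statistical depth function. That is, with $(\mathbf{D},\theta)=(\mathbf{EHD},x_{0,H})$ or $(\mathbf{D},\theta)=(\mathbf{EZD},\bar X)$: (a) (affine invariance) for every nonsingular $d\times d$ matrix $\mathbf{A}$, every $b\in\mathbb{R}^d$ and every $x\in\mathbb{R}^d$, $\mathbf{D}(\mathbf{A}x+b,P_{n,\mathbf{A}\mathcal{X}^n+b})=\mathbf{D}(x,P_n)$, where $P_{n,\mathbf{A}\mathcal{X}^n+b}$ is the empirical measure of $\{\mathbf{A}X_1+b,\dots,\mathbf{A}X_n+b\}$; (b) (maximality at a center point) $\mathbf{D}(\theta,P_n)=\sup_{x\in\mathbb{R}^d}\mathbf{D}(x,P_n)$; (c) (monotonicity relative to the center point) $\mathbf{D}(x,P_n)\le\mathbf{D}(\theta+\alpha(x-\theta),P_n)$ for all $x\in\mathbb{R}^d$ and $\alpha\in[0,1]$; (d) (vanishing at infinity) $\mathbf{D}(x,P_n)\to0$ as $\|x\|\to\infty$.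
   Context: General position: no more than $d$ of the data points lie in any $(d-1)$-dimensional hyperplane. $\mathbf{conv}(\mathcal{X}^n)$ is the convex hull of the data, $\bar X=\frac1n\sum_i X_i$, and $\mathcal{S}^{d-1}$ is the unit sphere of $\mathbb{R}^d$. Halfspace depth: $\mathbf{HD}(x,P_n)=\inf_{u\in\mathcal{S}^{d-1}}P_n(u^\top X\le u^\top x)$, i.e. the infimum over $u$ of $\frac1n\#\{i:u^\top X_i\le u^\top x\}$. The halfspace median $x_{0,H}$ is the average (centroid) of all points of the innermost halfspace depth region, i.e. of the set of maximizers of $\mathbf{HD}(\cdot,P_n)$. Zonoid depth: for $x\in\mathbf{conv}(\mathcal{X}^n)$, $$\mathbf{ZD}(x,P_n)=\sup\Big\{\alpha: x=\sum_{i=1}^n p_iX_i,\ \sum_{i=1}^n p_i=1,\ np_i\in[0,1/\alpha]\ \forall i\Big\},$$ and $\mathbf{ZD}(x,P_n)=0$ for $x\notin\mathbf{conv}(\mathcal{X}^n)$. Extended halfspace depth: $\mathbf{EHD}(x,P_n)=\mathbf{HD}(x,P_n)$ if $x\in\mathbf{conv}(\mathcal{X}^n)$, and $$\mathbf{EHD}(x,P_n)=\frac{\|x_c-x_{0,H}\|}{\|x-x_{0,H}\|}\cdot\frac1n\quad\text{if }x\notin\mathbf{conv}(\mathcal{X}^n),$$ where $x_c$ is the intersection point of the boundary of $\mathbf{conv}(\mathcal{X}^n)$ with the ray starting at $x_{0,H}$ and passing through $x$ (the point where this ray leaves $\mathbf{conv}(\mathcal{X}^n)$). Extended zonoid depth: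 $\mathbf{EZD}(x,P_n)=\mathbf{ZD}(x,P_n)$ if $x\in\mathbf{conv}(\mathcal{X}^n)$, and $$\mathbf{EZD}(x,P_n)=\frac{\|\tilde x_c-\bar X\|}{\|x-\bar X\|}\cdot\frac1n\quad\text{if }x\notin\mathbf{conv}(\mathcal{X}^n),$$ where $\tilde x_c$ is the intersection point of the boundary of $\mathbf{conv}(\mathcal{X}^n)$ with the ray starting at $\bar X$ and passing through $x$ (the point where this ray leaves $\mathbf{conv}(\mathcal{X}^n)$). *)

(* Defs.v *)
From HB Require Import structures.
From mathcomp Require Import all_boot all_order all_algebra.
From mathcomp Require Import all_classical all_reals all_analysis.

Set Implicit Arguments.
Unset Strict Implicit.
Unset Printing Implicit Defensive.

Import Order.TTheory GRing.Theory Num.Theory.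
Import numFieldNormedType.Exports.

Local Open Scope classical_set_scope.
Local Open Scope ring_scope.

Section Euclidean.
Context {R : realType} {d : nat}.
Implicit Types (u x y : 'cV[R]_d) (C : set 'cV[R]_d).

Definition dot u x : R := (u^T *m x) ord0 ord0.

(* The norm that MathComp-Analysis puts on matrices is the sup norm. *)
Definition enorm x : R := Num.sqrt (dot x x).

Definition unit_sphere : set 'cV[R]_d := [set u | enorm u = 1].

Definition boundary C : set 'cV[R]_d := closure C `\` interior C.

(* [c] is the boundary point of [C] at which the ray from [o] through [x]
   leaves [C].  When [C] has empty interior every point of [C] is a boundary
   point, hence the last clause. *)
Definition is_exit_point C (o x c : 'cV[R]_d) : Prop :=
  exists t : R, [/\ 0 <= t, c = o + t *: (x - o), boundary C c
    & forall s : R, t < s -> ~ C (o + s *: (x - o))].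

Definition exit_point C (o x : 'cV[R]_d) : 'cV[R]_d :=
  xget 0 (is_exit_point C o x).

End Euclidean.

Section LebesgueTuple.
Context {R : realType}.

Definition consT k (xy : measurableTypeR R * k.-tuple (measurableTypeR R)) :
    k.+1.-tuple (measurableTypeR R) :=
  [tuple of xy.1 :: xy.2].

Fact measurable_consT k : measurable_fun setT (@consT k).
Proof. exact: measurable_cons. Qed.

HB.instance Definition _ k :=
  @isMeasurableFun.Build _ _ _ _ (@consT k) (@measurable_consT k).

Section cons_measure.
Local Open Scope ereal_scope.
Variables (k : nat)
  (mu : {sigma_finite_measure set (k.-tuple (measurableTypeR R)) -> \bar R}).

Definition lebesgue_cons : set (k.+1.-tuple (measurableTypeR R)) -> \bar R :=
  pushforward (lebesgue_measure \x mu) (@consT k).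

Let lebesgue_cons0 : lebesgue_cons set0 = 0.
Proof. exact: measure0. Qed.

Let lebesgue_cons_ge0 A : 0 <= lebesgue_cons A.
Proof. exact: measure_ge0. Qed.

Let lebesgue_cons_sigma_additive : semi_sigma_additive lebesgue_cons.
Proof. exact: measure_semi_sigma_additive. Qed.

HB.instance Definition _ := isMeasure.Build _ _ _ lebesgue_cons
  lebesgue_cons0 lebesgue_cons_ge0 lebesgue_cons_sigma_additive.

Let lebesgue_cons_sigma_finite : sigma_finite setT lebesgue_cons.
Proof.
have /sigma_finiteP[F [TF ndF Foo]] := sigma_finiteT (@lebesgue_measure R).
have /sigma_finiteP[G [TG ndG Goo]] := sigma_finiteT mu.
pose g (t : k.+1.-tuple (measurableTypeR R)) := (thead t, [tuple of behead t]).
have mg : measurable_fun setT g.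
  by apply: measurable_fun_pair; [exact: measurable_tnth|exact: measurable_behead].
have gK : cancel (@consT k) g.
  by case=> x t; rewrite /g theadE; congr pair; exact/val_inj.
exists (fun i => g @^-1` (F i `*` G i)).
  apply/esym; rewrite -subTset => t _.
  have [[i _ Fi] [j _ Gj]] : (\bigcup_i F i) (g t).1 /\ (\bigcup_i G i) (g t).2.
    by rewrite -TF -TG.
  exists (maxn i j) => //; split.
  - by move: Fi; exact/subsetPset/ndF/leq_maxl.
  - by move: Gj; exact/subsetPset/ndG/leq_maxr.
move=> i; have [mF Fi] := Foo i; have [mG Gi] := Goo i; split.
  by rewrite -[X in measurable X]setTI; apply: mg => //; exact: measurableX.
rewrite /lebesgue_cons /pushforward -comp_preimage.
rewrite (_ : g \o _ = id); last exact/funext.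
by rewrite preimage_id product_measure1E// lte_mul_pinfty// ge0_fin_numE.
Qed.

HB.instance Definition _ := @Measure_isSigmaFinite.Build _ _ _
  lebesgue_cons lebesgue_cons_sigma_finite.

End cons_measure.

(* Lebesgue measure on R^k, the k-fold product of [lebesgue_measure]. *)
Fixpoint lebesgue_tuple k :
    {sigma_finite_measure set (k.-tuple (measurableTypeR R)) -> \bar R} :=
  match k with
  | 0 => dirac [tuple]
  | k'.+1 => lebesgue_cons (lebesgue_tuple k')
  end.

End LebesgueTuple.

Section Centroid.
Context {R : realType} {d : nat}.
Implicit Types (C : set 'cV[R]_d) (c o : 'cV[R]_d).

Definition affine_param k o (V : 'M[R]_(d, k))
    (y : k.-tuple (measurableTypeR R)) : 'cV[R]_d :=
  o + V *m \col_i tnth y i.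

(* A set of affine dimension k < d is Lebesgue-null in R^d, so the average is
   taken with respect to k-dimensional Lebesgue measure on the affine hull of
   [C], in an injective affine parametrization of it: [C] lies in the range of
   the parametrization and has positive k-dimensional measure. *)
Definition is_centroid C c : Prop :=
  exists (k : nat) (o : 'cV[R]_d) (V : 'M[R]_(d, k)),
    let K := affine_param o V @^-1` C in
    let vol := lebesgue_tuple k K in
    [/\ \rank V = k,
        C `<=` range (affine_param o V),
        measurable K /\ (0 < vol < +oo)%E,
        forall i : 'I_k, (lebesgue_tuple k).-integrable K
          (fun y => (tnth y i : R)%:E) &
        c = o + V *m \col_(i < k)
          ((fine vol)^-1 * \int[lebesgue_tuple k]_(y in K) (tnth y i : R))].

Definition centroid C : 'cV[R]_d := xget 0 (is_centroid C).

End Centroid.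

Section DataDepth.
Context {R : realType} {d n : nat}.
Implicit Types (X : 'I_n -> 'cV[R]_d) (x : 'cV[R]_d).

Definition general_position X : Prop :=
  forall (u : 'cV[R]_d) (b : R), u != 0 ->
    (#|[pred i | dot u (X i) == b]| <= d)%N.

Definition empirical X (A : set 'cV[R]_d) : R :=
  #|[pred i | X i \in A]|%:R / n%:R.

Definition data_hull X : set 'cV[R]_d :=
  [set x | exists p : 'I_n -> R,
    [/\ forall i, 0 <= p i, \sum_i p i = 1 & x = \sum_i p i *: X i]].

Definition data_mean X : 'cV[R]_d := n%:R^-1 *: \sum_i X i.

Definition HD X x : R :=
  inf [set empirical X [set y | dot u y <= dot u x] | u in unit_sphere].

Definition halfspace_median_region X : set 'cV[R]_d :=
  [set x | forall y, HD X y <= HD X x].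

Definition halfspace_median X : 'cV[R]_d :=
  centroid (halfspace_median_region X).

Definition ZD X x : R :=
  if x \in data_hull X then
    sup [set alpha : R | 0 < alpha /\ exists p : 'I_n -> R,
      [/\ x = \sum_i p i *: X i, \sum_i p i = 1
        & forall i, 0 <= n%:R * p i <= 1 / alpha]]
  else 0.

Definition outside_depth X (o x : 'cV[R]_d) : R :=
  enorm (exit_point (data_hull X) o x - o) / enorm (x - o) * (1 / n%:R).

Definition EHD X x : R :=
  if x \in data_hull X then HD X x
  else outside_depth X (halfspace_median X) x.

Definition EZD X x : R :=
  if x \in data_hull X then ZD X x
  else outside_depth X (data_mean X) x.

End DataDepth.

Section DepthProperties.
Context {R : realType} {d n : nat}.
Variables (D : ('I_n -> 'cV[R]_d) -> 'cV[R]_d -> R)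
  (theta : ('I_n -> 'cV[R]_d) -> 'cV[R]_d) (X : 'I_n -> 'cV[R]_d).

Definition affine_invariance : Prop :=
  forall (A : 'M[R]_d) (b x : 'cV[R]_d), A \in unitmx ->
    D (fun i => A *m X i + b) (A *m x + b) = D X x.

(* The supremum is taken in the extended reals: the real-valued [sup] of an
   unbounded set is 0. *)
Definition maximality_at_center : Prop :=
  (D X (theta X))%:E = ereal_sup [set (D X x)%:E | x in [set: 'cV[R]_d]].

Definition monotonicity_from_center : Prop :=
  forall (x : 'cV[R]_d) (alpha : R), 0 <= alpha <= 1 ->
    D X x <= D X (theta X + alpha *: (x - theta X)).

Definition vanishing_at_infinity : Prop :=
  forall e : R, 0 < e ->
    exists M : R, forall x : 'cV[R]_d, M < enorm x -> `|D X x| < e.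

Definition statistical_depth_function : Prop :=
  [/\ affine_invariance, maximality_at_center, monotonicity_from_center
    & vanishing_at_infinity].

End DepthProperties.

(* Main.v *)
Require Import Defs.
From mathcomp Require Import all_boot all_order all_algebra.
From mathcomp Require Import all_classical all_reals all_analysis.
From mathcomp Require Import measurable_realfun ring lra.

(* Both depths are extensions, along rays from a center in the hull, of a depth
   that is at least 1/n on the hull.  The ray leaves the compact hull at a
   parameter t < 1 which is invariant under affine maps, so the outside depth
   is t/n; this gives all four properties once the depth on the hull is affine
   invariant and monotone along rays from the center.

   For the halfspace depth, the real work is to show that the centroid of the
   median region is a well-defined, affinely equivariant point of the region.
   Existence: the region is convex and bounded, and it is a countable
   intersection of measurable sets because rational directions suffice, so in
   coordinates of a maximal affine frame of its points it contains a small cube.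
   Independence of the parametrization: two parametrizations differ by an
   invertible affine map T, since hyperplanes are null; and by Tonelli and
   translation invariance
     lambda(T^-1 A) lambda(U) = lambda(T^-1 U) lambda(-A),
   so T rescales Lebesgue measure by a constant, which cancels in the average.
   Membership: the region is cut out by halfspaces, and an average over a set
   stays in every halfspace containing it. *)

Set Implicit Arguments.
Unset Strict Implicit.
Unset Printing Implicit Defensive.

Import Order.TTheory GRing.Theory Num.Theory.
Import numFieldNormedType.Exports.

Local Open Scope classical_set_scope.
Local Open Scope ring_scope.

(** * Lebesgue measure on tuples *)

Section TupleMeasure.
Context {R : realType}.
Notation RT := (measurableTypeR R).
Notation lam := lebesgue_tuple.

(** Bundles a pushforward with its measure structure, so that uniqueness theorems for measures apply
    to it. It is kept transparent so that its value on a set unfolds by computation. *)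
Definition image_measure d1 d2 (T1 : measurableType d1) (T2 : measurableType d2)
    (mu : {measure set T1 -> \bar R}) (f : T1 -> T2)
    (mf : measurable_fun setT f) : {measure set T2 -> \bar R}.
Proof. by refine (pushforward mu f : {measure set T2 -> \bar R}); exact: mf. Defined.

Lemma image_measureE d1 d2 (T1 : measurableType d1) (T2 : measurableType d2)
    (mu : {measure set T1 -> \bar R}) (f : T1 -> T2)
    (mf : measurable_fun setT f) A : image_measure mu mf A = mu (f @^-1` A).
Proof. by []. Qed.

(** [tcol] and [colt] pass between tuples, which carry the product sigma-algebra and the measure,
    and column vectors, which carry the linear algebra. *)
Definition tcol k (y : k.-tuple RT) : 'cV[R]_k := \col_i (tnth y i : R).
Definition colt k (v : 'cV[R]_k) : k.-tuple RT := [tuple (v i ord0 : RT) | i < k].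

Lemma tcolK k : cancel (@tcol k) (@colt k).
Proof. by move=> y; apply: eq_from_tnth => i; rewrite tnth_mktuple mxE. Qed.

Lemma coltK k : cancel (@colt k) (@tcol k).
Proof. by move=> v; apply/colP => i; rewrite mxE tnth_mktuple. Qed.

Lemma tnth_colt k (v : 'cV[R]_k) i : tnth (colt v) i = v i ord0.
Proof. by rewrite tnth_mktuple. Qed.

Lemma measurable_colt d (T : measurableType d) k (f : T -> 'cV[R]_k) :
  (forall i, measurable_fun setT (fun t => f t i ord0 : RT)) ->
  measurable_fun setT (fun t => colt (f t)).
Proof.
move=> mf; apply/measurable_fun_tnthP => i.
rewrite (_ : _ \o _ = fun t => f t i ord0)//.
by apply/funext => t /=; rewrite tnth_colt.
Qed.

Lemma measurable_tcol_mul d (T : measurableType d) k l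
    (B : 'M[R]_(l, k)) (f : T -> k.-tuple RT) i :
  measurable_fun setT f ->
  measurable_fun setT (fun t => (B *m tcol (f t)) i ord0 : RT).
Proof.
move=> mf; rewrite (_ : (fun _ => _) = fun t => \sum_j B i j * tnth (f t) j).
  apply: (@measurable_sum _ _ R _ _ _ (fun j t => B i j * tnth (f t) j)) => j.
  apply: measurable_funM; first exact: measurable_cst.
  by apply: (measurableT_comp (measurable_tnth _)).
by apply/funext => t; rewrite mxE; apply: eq_bigr => j _; rewrite mxE.
Qed.

Lemma measurable_affine_tuple d (T : measurableType d) k l
    (B : 'M[R]_(l, k)) (v : 'cV[R]_l) (f : T -> k.-tuple RT) :
  measurable_fun setT f ->
  measurable_fun setT (fun t => colt (B *m tcol (f t) + v)).
Proof.
move=> mf; apply: measurable_colt => i.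
rewrite (_ : (fun _ => _) =
  fun t => (B *m tcol (f t)) i ord0 + v i ord0); last first.
  by apply/funext => t; rewrite mxE.
apply: measurable_funD; last exact: measurable_cst.
exact: measurable_tcol_mul.
Qed.

(** The shifted measure gives half-open intervals their length, and this determines Lebesgue
    measure. *)
Lemma lebesgue_measure_shift (c : R) (A : set RT) : measurable A ->
  lebesgue_measure ((fun x : RT => x + c) @^-1` A) = lebesgue_measure A.
Proof.
move=> mA.
have ms : measurable_fun setT (fun x : RT => x + c : RT).
  by apply: measurable_funD; [exact: measurable_id|exact: measurable_cst].
pose m' : {measure set RT -> \bar R} :=
  image_measure lebesgue_measure ms.
apply/esym; apply: (@lebesgue_measure_unique R m') => // X [[a b] _ <-].
rewrite image_measureE.
rewrite (_ : _ @^-1` _ = `](a - c), (b - c)]%classic); last first.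
  by apply/seteqP; split => x /=; rewrite !in_itv/= ltrBlDr lerBrDr.
rewrite [LHS](lebesgue_measure_itv `]a, b]).
rewrite [RHS](lebesgue_measure_itv `](a - c), (b - c)]).
by rewrite /= !lte_fin ltrD2r -!EFinB opprB addrA subrK.
Qed.

(** A translation acts on the head and on the tail separately. By induction its image of the product
    measure has the right value on rectangles, and uniqueness of product measures concludes. *)
Lemma lebesgue_tuple_shift k (v : 'cV[R]_k) A : measurable A ->
  lam k ((fun y => colt (tcol y + v)) @^-1` A) = lam k A.
Proof.
elim: k v A => [|k IH] v A mA.
  by congr (lam 0 _); apply/seteqP; split => y /=; rewrite (tuple0 y) (tuple0 (colt _)).
pose c := v ord0 ord0; pose w : 'cV[R]_k := \col_i v (lift ord0 i) ord0.
pose phi (z : RT * k.-tuple RT) : RT * k.-tuple RT :=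
  (z.1 + c, colt (tcol z.2 + w)).
have ms : measurable_fun setT (fun x : RT => x + c : RT).
  by apply: measurable_funD; [exact: measurable_id|exact: measurable_cst].
have mt : measurable_fun setT (fun t : k.-tuple RT => colt (tcol t + w)).
  under eq_fun do rewrite -[tcol _]mul1mx.
  exact: (@measurable_affine_tuple _ _ _ _ _ _ id).
have mphi : measurable_fun setT phi.
  apply: measurable_fun_pair.
    exact: (measurableT_comp ms measurable_fst).
  exact: (measurableT_comp mt measurable_snd).
have mcA : measurable (@consT R k @^-1` A).
  by rewrite -[X in measurable X]setTI; exact: measurable_consT.
transitivity ((lebesgue_measure \x lam k)%E (phi @^-1` (@consT R k @^-1` A))).
  congr ((lebesgue_measure \x lam k)%E _); apply/seteqP.
  have E z : colt (tcol (consT z) + v) = consT (phi z).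
    apply: eq_from_tnth => i; rewrite tnth_colt mxE mxE.
    have [j ->|->] := unliftP ord0 i; last by rewrite !tnth0.
    by rewrite !tnthS tnth_colt mxE mxE mxE.
  by split => z /=; rewrite E.
rewrite -(@image_measureE _ _ _ _ _ _ mphi).
apply/esym/product_measure_unique => // B C mB mC.
transitivity ((lebesgue_measure \x lam k)%E
  (((fun x : RT => x + c : RT) @^-1` B) `*`
   ((fun t => colt (tcol t + w)) @^-1` C))); first by [].
rewrite product_measure1E ?IH//.
- by congr (_ * _)%E; exact: lebesgue_measure_shift.
- by rewrite -[X in measurable X]setTI; exact: ms.
- by rewrite -[X in measurable X]setTI; exact: mt.
Qed.

Definition box k (a b : R) : set (k.-tuple RT) :=
  [set y | forall i, a <= tnth y i <= b].

Arguments box : clear implicits.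

Lemma box_cons k a b : @consT R k @^-1` box k.+1 a b = `[a, b]%classic `*` box k a b.
Proof.
apply/seteqP; split => -[x t] /=.
  move=> h; split => /=.
    by have := h ord0; rewrite tnth0 in_itv.
  by move=> i; have := h (lift ord0 i); rewrite tnthS.
rewrite in_itv/= => -[h1 h2] i.
have [j ->|->] := unliftP ord0 i; last by rewrite tnth0.
by rewrite tnthS.
Qed.

Lemma measurable_box k a b : measurable (box k a b).
Proof.
rewrite (_ : box k a b =
  \bigcap_(i in [set: 'I_k]) ((fun y => tnth y i) @^-1` `[a, b]%classic)).
  apply: fin_bigcap_measurable => // i _; rewrite -[X in measurable X]setTI.
  by apply: measurable_tnth => //; exact: measurable_itv.
apply/seteqP; split => y /= h i.
  by move=> _; rewrite /= in_itv/=; exact: h.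
by have := h i I; rewrite /= in_itv.
Qed.

Lemma lebesgue_tuple_box k (a b : R) : a <= b ->
  lam k (box k a b) = ((b - a) ^+ k)%:E.
Proof.
move=> ab; elim: k => [|k IH].
  by rewrite /= diracE mem_set// => -[].
rewrite (_ : lam k.+1 _ =
  (lebesgue_measure \x lam k)%E (@consT R k @^-1` box k.+1 a b))//.
rewrite box_cons product_measure1E//; last exact: measurable_box.
rewrite exprS EFinM; congr (_ * _)%E; last exact: IH.
rewrite [LHS](lebesgue_measure_itv `[a, b]) /= lte_fin.
by rewrite -EFinB; case: ltgtP ab => // -> _; rewrite subrr.
Qed.

Lemma measurable_preimage_tuple d (T : measurableType d) k (f : T -> k.-tuple RT) A :
  measurable_fun setT f -> measurable A -> measurable (f @^-1` A).
Proof. by move=> mf mA; rewrite -[X in measurable X]setTI; exact: mf. Qed.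

Lemma measurable_hyperplane k (w : 'rV[R]_k) (b : R) :
  measurable [set y : k.-tuple RT | (w *m tcol y) ord0 ord0 = b].
Proof.
rewrite -[X in measurable X]setTI.
apply: (@measurable_tcol_mul _ _ _ _ w id ord0 (@measurable_id _ _ _) _ [set b]) => //.
Qed.

(** Induction with Tonelli. If the tail [w'] of the normal vector vanishes, the equation fixes the
    head, and the sections at a fixed tail are single points. Otherwise the sections at a fixed head
    are hyperplanes one dimension lower. *)
Lemma lebesgue_tuple_hyperplane k (w : 'rV[R]_k) (b : R) : w != 0 ->
  lam k [set y | (w *m tcol y) ord0 ord0 = b] = 0%E.
Proof.
elim: k w b => [|k IH] w b w0; first by rewrite thinmx0 eqxx in w0.
pose w' : 'rV[R]_k := \row_i w ord0 (lift ord0 i).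
pose H := [set z : RT * k.-tuple RT |
  w ord0 ord0 * z.1 + (w' *m tcol z.2) ord0 ord0 = b].
have HE : @consT R k @^-1` [set y | (w *m tcol y) ord0 ord0 = b] = H.
  have E z : (w *m tcol (consT z)) ord0 ord0 =
      w ord0 ord0 * z.1 + (w' *m tcol z.2) ord0 ord0.
    rewrite !mxE big_ord_recl mxE tnth0; congr (_ + _).
    by apply: eq_bigr => i _; rewrite !mxE tnthS.
  by apply/seteqP; split => z /=; rewrite E.
have mH : measurable H.
  rewrite -HE -[X in measurable X]setTI; apply: measurable_consT => //.
  exact: measurable_hyperplane.
rewrite (_ : lam k.+1 _ = (lebesgue_measure \x lam k)%E H); last by rewrite -HE.
have [w'0|w'0] := eqVneq w' 0.
  have w00 : w ord0 ord0 != 0.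
    apply: contra w0 => /eqP w00; apply/eqP/rowP => i; rewrite mxE.
    have [j ->|->//] := unliftP ord0 i.
    by have /rowP/(_ j) := w'0; rewrite !mxE.
  rewrite (@product_measure_unique _ _ _ _ _ _ _
    (lebesgue_measure \x^ lam k)%E)//; last first.
    by move=> B C mB mC; exact: product_measure2E.
  rewrite [LHS]integral0_eq// => t _ /=.
  rewrite (_ : ysection H t = [set b / w ord0 ord0]) ?lebesgue_measure_set1//.
  apply/seteqP; split => x; rewrite /ysection /= inE /H /= w'0 mul0mx mxE addr0.
    by move=> <-; rewrite mulrAC mulfV// mul1r.
  by move=> ->; rewrite mulrC divfK.
rewrite [LHS]integral0_eq// => x _ /=.
rewrite -[RHS](IH w' (b - w ord0 ord0 * x) w'0); congr (lam k _).
apply/seteqP; split => t; rewrite /xsection /= inE /H /=.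
  by move=> <-; rewrite addrAC subrr add0r.
by move=> ->; rewrite addrC subrK.
Qed.

End TupleMeasure.
Arguments box {R} k a b.

(** * Linear changes of variables for Lebesgue measure *)

Section LinearChange.
Context {R : realType}.
Notation RT := (measurableTypeR R).
Notation lam := lebesgue_tuple.

(** Both sides compute the measure of [E], the pairs (x, y) with Bx in A and Bx + y in U. For fixed
    x the section is a translate of U, which gives the left side. For fixed y, replacing x by x -
    B^-1 y turns [E] into [E'], where Bx lies in U and Bx - y in A; the sections of [E'] at fixed x
    are translates of -A, which gives the right side. *)
Lemma lebesgue_tuple_swap k (B : 'M[R]_k) (A U : set (k.-tuple RT)) :
  B \in unitmx -> measurable A -> measurable U ->
  (lam k ((fun y => colt (B *m tcol y)) @^-1` A) * lam k U =
   lam k ((fun y => colt (B *m tcol y)) @^-1` U) *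
   lam k ((fun y => colt (- tcol y)) @^-1` A))%E.
Proof.
move=> uB mA mU.
pose L (y : k.-tuple RT) := colt (B *m tcol y).
have mL : measurable_fun setT L.
  by apply: measurable_colt => i; exact: (@measurable_tcol_mul _ _ _ _ _ _ id).
have mN : measurable_fun setT (fun y : k.-tuple RT => colt (- tcol y)).
  rewrite (_ : (fun _ => _) = fun y => colt (- 1%:M *m tcol y)).
    by apply: measurable_colt => i; exact: (@measurable_tcol_mul _ _ _ _ _ _ id).
  by apply/funext => y; rewrite mulNmx mul1mx.
have mf1 : measurable_fun setT (fun z : k.-tuple RT * k.-tuple RT => L z.1).
  exact: (measurableT_comp mL measurable_fst).
have mcomb (C D : 'M[R]_k) : measurable_fun setT (fun z : k.-tuple RT * k.-tuple RT =>
    colt (C *m tcol z.1 + D *m tcol z.2)).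
  apply: measurable_colt => i; under eq_fun do rewrite mxE.
  by apply: measurable_funD; exact: measurable_tcol_mul.
pose E := [set z : k.-tuple RT * k.-tuple RT | A (L z.1) /\
   U (colt (B *m tcol z.1 + 1%:M *m tcol z.2))].
pose E' := [set z : k.-tuple RT * k.-tuple RT |
   A (colt (B *m tcol z.1 + (- 1%:M) *m tcol z.2)) /\ U (L z.1)].
have mE : measurable E.
  by apply: measurableI; exact: measurable_preimage_tuple.
have mE' : measurable E'.
  by apply: measurableI; exact: measurable_preimage_tuple.
have fub X : measurable X -> (lam k \x lam k)%E X = (lam k \x^ lam k)%E X.
  move=> mX; apply: (@product_measure_unique _ _ _ _ _ _ _ (lam k \x^ lam k)%E) => //.
  by move=> ? ? ? ?; exact: product_measure2E.
have prodC X Y c : measurable X -> measurable Y ->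
    (forall x, lam k (xsection X x) = (\1_Y x)%:E * c)%E ->
    (0 <= c)%E -> ((lam k \x lam k) X = lam k Y * c)%E.
  move=> mX mY Xc c0; rewrite [LHS](eq_integral (fun x => (\1_Y x)%:E * c)%E).
    rewrite ge0_integralZr//; first by rewrite integral_indic// setIT.
    exact: measurableT_comp.
  by move=> x _; exact: Xc.
transitivity ((lam k \x lam k)%E E).
  apply/esym/prodC => //; first exact: measurable_preimage_tuple.
  move=> x; rewrite indicE; have [/set_mem xA|/negP xA] := boolP (x \in _).
    rewrite mul1e -(lebesgue_tuple_shift (B *m tcol x) mU); congr (lam k _).
    apply/seteqP; split => y; rewrite /xsection/= inE /E/= mul1mx addrC.
      by case.
    by [].
  rewrite mul0e (_ : xsection E x = set0) ?measure0//.
  apply/seteqP; split => y //; rewrite /xsection/= inE => -[xA' _].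
  by apply: xA; rewrite inE.
transitivity ((lam k \x lam k)%E E').
  rewrite !fub//; apply: eq_integral => y _ /=.
  rewrite -(lebesgue_tuple_shift (invmx B *m tcol y) (measurable_ysection y mE')).
  congr (lam k _); apply/seteqP; split => x;
    rewrite /ysection/= !inE /E /E' /L/= coltK mulmxDr mulmxA mulmxV// !mul1mx;
    by rewrite mulNmx mul1mx addrK.
apply: prodC => //; first exact: measurable_preimage_tuple.
move=> x; rewrite indicE; have [/set_mem xU|/negP xU] := boolP (x \in _).
  rewrite mul1e.
  rewrite -(lebesgue_tuple_shift (- (B *m tcol x)) (measurable_preimage_tuple mN mA)).
  congr (lam k _); apply/seteqP; split => y;
    rewrite /xsection/= inE /E'/= coltK opprD opprK mulNmx mul1mx addrC //.
  by case.
rewrite mul0e (_ : xsection E' x = set0) ?measure0//.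
apply/seteqP; split => y //; rewrite /xsection/= inE => -[_ xU'].
by apply: xU; rewrite inE.
Qed.

(** Taking U to be the unit cube in the swap identity leaves the measure of the preimage of that
    cube as the scaling factor, so no determinant has to be computed. *)
Lemma lebesgue_tuple_linear k (B : 'M[R]_k) (A : set (k.-tuple RT)) :
  B \in unitmx -> measurable A ->
  (lam k ((fun y => colt (B *m tcol y)) @^-1` A) =
   lam k ((fun y => colt (B *m tcol y)) @^-1` box k 0 1) * lam k A)%E.
Proof.
move=> uB mA.
have box1 : lam k (box k 0 1 : set (k.-tuple RT)) = 1%E :> \bar R.
  by rewrite lebesgue_tuple_box// subr0 expr1n.
have preid (X : set (k.-tuple RT)) : (fun y => colt (1%:M *m tcol y)) @^-1` X = X.
  by apply/seteqP; split => y /=; rewrite mul1mx tcolK.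
(* [B = 1%:M] in the swap lemma yields invariance under reflection. *)
have := lebesgue_tuple_swap (unitmx1 _ _) mA (@measurable_box R k 0 1).
rewrite !preid box1 mule1 mul1e => ->.
by rewrite -(lebesgue_tuple_swap uB mA (@measurable_box R k 0 1)) box1 mule1.
Qed.

Lemma lebesgue_tuple_affine k (B : 'M[R]_k) (a : 'cV[R]_k) : B \in unitmx ->
  exists2 c : \bar R, (0 <= c)%E & forall A : set (k.-tuple RT), measurable A ->
  (lam k ((fun y => colt (B *m tcol y + a)) @^-1` A) = c * lam k A)%E.
Proof.
move=> uB; exists (lam k ((fun y => colt (B *m tcol y)) @^-1` box k 0 1)) => //.
move=> A mA; rewrite -(lebesgue_tuple_shift a mA) -lebesgue_tuple_linear//.
  by congr (lam k _); apply/seteqP; split => y /=; rewrite coltK.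
apply: measurable_preimage_tuple => //.
rewrite (_ : (fun _ => _) = fun y => colt (1%:M *m tcol y + a)).
  exact: (@measurable_affine_tuple _ _ _ _ _ _ _ id).
by apply/funext => y; rewrite mul1mx.
Qed.

End LinearChange.

(** * Centroids *)

Section CentroidUnique.
Context {R : realType}.
Notation RT := (measurableTypeR R).
Notation lam := lebesgue_tuple.

(** Reduces to positive and negative parts; integrability makes their difference well defined before
    and after scaling. *)
Lemma integral_mscale d (T : measurableType d) (mu : {measure set T -> \bar R})
    (D : set T) (k : {nonneg R}) (f : T -> \bar R) :
  measurable D -> mu.-integrable D f ->
  (\int[mscale k mu]_(x in D) f x = k%:num%:E * \int[mu]_(x in D) f x)%E.
Proof.
move=> mD intf; have mf := measurable_int mu intf.
rewrite [LHS]integralE [in RHS]integralE.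
rewrite !ge0_integral_mscale//; [|exact: measurable_funeneg|exact: measurable_funepos].
rewrite [RHS]muleBr//; apply: fin_num_adde_defr.
by apply: integrable_fin_num => //; exact: integrable_funepos.
Qed.

Lemma integrable_cst_lty d (T : measurableType d) (mu : {measure set T -> \bar R})
    (D : set T) (b : R) :
  measurable D -> (mu D < +oo)%E -> mu.-integrable D (fun=> b%:E).
Proof.
move=> mD Doo; apply: (@measurable_bounded_integrable _ _ _ mu (fun=> b)) => //.
exact: bounded_cst.
Qed.

(** The unnormalized first moment: divided by the volume of [K] it gives the coordinates of the
    centroid in the parametrization. *)
Definition moment k (K : set (k.-tuple RT)) : 'cV[R]_k :=
  \col_(i < k) \int[lam k]_(y in K) (tnth y i : R).

Section AffineIntegrals.
Variables (k : nat) (K : set (k.-tuple RT)).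
Hypotheses (mK : measurable K) (finK : (lam k K < +oo)%E).
Hypothesis intK : forall i : 'I_k,
  (lam k).-integrable K (fun y => (tnth y i : R)%:E).

Lemma integrable_affine (w : 'rV[R]_k) (b : R) :
  (lam k).-integrable K (fun y => ((w *m tcol y) ord0 ord0 + b)%:E).
Proof.
under eq_fun do rewrite EFinD.
apply: integrableD => //; last exact: integrable_cst_lty.
under eq_fun do rewrite mxE -sumEFin.
apply: integrable_sum => // i _.
under eq_fun do rewrite mxE EFinM.
exact: integrableZl.
Qed.

Lemma Rintegral_affine (w : 'rV[R]_k) (b : R) :
  \int[lam k]_(y in K) ((w *m tcol y) ord0 ord0 + b) =
  (w *m moment K) ord0 ord0 + b * fine (lam k K).
Proof.
have intw := integrable_affine w 0.
rewrite RintegralD//; first last.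
- exact: integrable_cst_lty.
- by move: intw; under eq_fun do rewrite addr0.
congr (_ + _); last by rewrite Rintegral_cst.
rewrite /Rintegral.
under eq_integral do rewrite mxE -sumEFin.
rewrite integral_sum//; last first.
  move=> i; under eq_fun do rewrite mxE EFinM.
  exact: integrableZl.
rewrite mxE -sum_fine; last first.
  move=> i _; apply: integrable_fin_num => //.
  under eq_fun do rewrite mxE EFinM.
  exact: integrableZl.
apply: eq_bigr => i _; rewrite mxE /Rintegral.
under eq_integral do rewrite mxE EFinM.
rewrite integralZl// fineM//.
exact: integrable_fin_num.
Qed.

End AffineIntegrals.

(** Integrate the inequality over the parameter set: by [Rintegral_affine] the integral of an affine
    function is its value at the centroid times the volume. *)
Lemma centroid_halfspace d (C : set 'cV[R]_d) c (u : 'cV[R]_d) (q : R) :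
  is_centroid C c -> (forall x, C x -> q <= dot u x) -> q <= dot u c.
Proof.
move=> [k [z [V [rV CV [mK /andP[K0 Koo]] intK ->]]]] qC.
set K := _ @^-1` C in mK K0 Koo intK *.
have fK : lam k K \is a fin_num by rewrite ge0_fin_numE.
have v0 : 0 < fine (lam k K) by apply: fine_gt0; rewrite K0.
have colE : \col_(i < k) ((fine (lam k K))^-1 * \int[lam k]_(y in K) (tnth y i : R))
   = (fine (lam k K))^-1 *: moment K by apply/colP => i; rewrite !mxE.
have E y : dot u (z + V *m y) = ((u^T *m V) *m y) ord0 ord0 + dot u z.
  by rewrite /dot mulmxDr mxE addrC mulmxA.
rewrite colE E -scalemxAr mxE -(ler_pM2r v0) mulrDl mulrAC mulVf ?gt_eqF// mul1r.
rewrite -Rintegral_affine// -Rintegral_cst//.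
apply: le_Rintegral => //.
- exact: integrable_cst_lty.
- exact: integrable_affine.
- by move=> y Ky; rewrite -E; exact: qC.
Qed.

Lemma left_inverse_full_rank d k (V : 'M[R]_(d, k)) :
  \rank V = k -> exists W, W *m V = 1%:M.
Proof. by move=> rV; apply/row_fullP; rewrite /row_full rV. Qed.

(** The matrix [P] kills the range of [V'], and P M = 0 forces M to factor through [V']. On [K] the
    vector P V y is constant, so a nonzero row of P V would confine [K] to a null hyperplane. Hence
    P V = 0, and evaluating at one point of [K] shows that P kills o - o' as well. *)
Lemma affine_param_sub d (C : set 'cV[R]_d) k o (V : 'M[R]_(d, k))
    k' o' (V' : 'M[R]_(d, k')) :
  let K := affine_param o V @^-1` C in
  measurable K -> (0 < lam k K)%E -> \rank V' = k' ->
  C `<=` range (affine_param o' V') ->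
  exists B a, V = V' *m B /\ o = o' + V' *m a.
Proof.
move=> K mK K0 /left_inverse_full_rank[W' W'V'] CV'.
pose P : 'M[R]_d := 1%:M - V' *m W'.
have PV' : P *m V' = 0 by rewrite mulmxBl mul1mx -mulmxA W'V' mulmx1 subrr.
have PK y : K y -> P *m (V *m tcol y) = - (P *m (o - o')).
  move=> /CV'[y' _ E]; apply/eqP; rewrite -addr_eq0 -mulmxDr addrA [_ + o]addrC.
  have -> : o + V *m tcol y = o' + V' *m tcol y' by exact/esym/E.
  by rewrite addrAC subrr add0r mulmxA PV' mul0mx.
have PV : P *m V = 0.
  apply/row_matrixP => i; rewrite row0; apply/eqP/negPn/negP => Pi.
  have := lebesgue_tuple_hyperplane ((- (P *m (o - o'))) i ord0) Pi.
  apply/eqP; rewrite gt_eqF// (lt_le_trans K0)//.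
  apply: le_measure; rewrite ?inE//; first exact: measurable_hyperplane.
  by move=> y /PK /= Ky; rewrite -row_mul mxE -mulmxA Ky.
have [y Ky] : exists y, K y.
  apply/not_existsP => K_eq0; move: K0; rewrite (_ : K = set0) ?measure0 ?ltxx//.
  by apply/seteqP; split => // y /K_eq0.
have PX l (M : 'M[R]_(d, l)) : P *m M = 0 -> M = V' *m (W' *m M).
  by move=> /eqP; rewrite mulmxBl mul1mx subr_eq0 -mulmxA => /eqP.
exists (W' *m V), (W' *m (o - o')); split; first exact: PX.
apply/eqP; rewrite addrC -subr_eq; apply/eqP/PX.
by apply/eqP; rewrite -oppr_eq0 -(PK _ Ky) mulmxA PV mul0mx.
Qed.

(** [affine_param_sub] in both directions gives mutually inverse [B] and [B'], hence equal
    dimensions and an affine change of parameters [T] with K = T^-1 K'. Volume and first moment then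
    transform with the same factor [r], which cancels in their quotient. *)
Lemma centroid_unique d (C : set 'cV[R]_d) c c' :
  is_centroid C c -> is_centroid C c' -> c = c'.
Proof.
move=> [k [z [V [rV CV [mK /andP[K0 Koo]] intK cE]]]].
move=> [k' [z' [V' [rV' CV' [mK' /andP[K0' Koo']] intK' cE']]]].
have [B [a [VE zE]]] := affine_param_sub mK K0 rV' CV'.
have [B' [_ [VE' _]]] := affine_param_sub mK' K0' rV CV.
have [W WV] := left_inverse_full_rank rV.
have [W' WV'] := left_inverse_full_rank rV'.
have VBB : V = V *m (B' *m B) by rewrite mulmxA -VE' -VE.
have VBB' : V' = V' *m (B *m B') by rewrite mulmxA -VE -VE'.
have B'B : B' *m B = 1%:M by rewrite -WV [in RHS]VBB mulmxA WV mul1mx.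
have BB' : B *m B' = 1%:M by rewrite -WV' [in RHS]VBB' mulmxA WV' mul1mx.
have kk' : k = k'.
  by apply/eqP; rewrite eqn_leq (mulmx1_min B'B) (mulmx1_min BB').
subst k'; have [_ uB] := mulmx1_unit B'B.
set K := _ @^-1` C in mK K0 Koo intK cE.
set K' := _ @^-1` C in mK' K0' Koo' intK' cE'.
pose T (y : k.-tuple RT) := colt (B *m tcol y + a).
have KT : K = T @^-1` K'.
  apply/seteqP; split => y;
  rewrite /K /K' /= /affine_param -/(tcol _) -/(tcol _) coltK;
  rewrite VE zE -addrA -mulmxA -mulmxDr [a + _]addrC; exact: id.
have mT : measurable_fun setT T by exact: (@measurable_affine_tuple _ _ _ _ _ _ _ id).
have [r r0 rE] := lebesgue_tuple_affine a uB.
have vE : lam k K = (r * lam k K')%E by rewrite KT rE.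
have fK : lam k K \is a fin_num by rewrite ge0_fin_numE.
have fK' : lam k K' \is a fin_num by rewrite ge0_fin_numE.
(* An infinite factor would give [K] infinite volume, since [K'] has positive volume. *)
have rfin : r \is a fin_num.
  rewrite ge0_fin_numE// ltNge leye_eq; apply/negP => /eqP roo.
  by move: Koo; rewrite vE roo gt0_mulye// ltxx.
pose s : {nonneg R} := NngNum (fine_ge0 r0).
have sE : s%:num%:E = r by rewrite /= fineK.
have v0 : fine (lam k K) != 0 by rewrite gt_eqF// fine_gt0// K0.
have v0' : fine (lam k K') != 0 by rewrite gt_eqF// fine_gt0// K0'.
have fvE : fine (lam k K) = s%:num * fine (lam k K') by rewrite vE fineM.
(* Integrating T over [K] in two ways: as a pushforward, which is r times Lebesgue measure on [K'],
   and as an affine function of y. *)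
have momE : s%:num *: moment K' = B *m moment K + fine (lam k K) *: a.
  apply/colP => i; rewrite !mxE.
  transitivity ((row i B *m moment K) ord0 ord0 + a i ord0 * fine (lam k K)); last first.
    by rewrite -row_mul mxE mxE mulrC.
  rewrite -Rintegral_affine// /Rintegral -{1}[s%:num]/(fine s%:num%:E).
  rewrite -fineM//; last first.
    exact: integrable_fin_num.
  rewrite -integral_mscale//; congr fine.
  have mti : measurable_fun setT (fun y : k.-tuple RT => (tnth y i : R)%:E).
    by apply/measurable_EFinP; exact: measurable_tnth.
  have TE y : (tnth (T y) i : R) = (row i B *m tcol y) ord0 ord0 + a i ord0.
    by rewrite tnth_colt [LHS]mxE -row_mul [X in _ = X + _]mxE.
  rewrite KT; under [RHS]eq_integral do rewrite -TE.
  rewrite -(@integral_pushforward _ _ _ _ _ _ mT (lam k) K' _ mti)//; last first.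
    rewrite -KT.
    apply: eq_integrable (integrable_affine mK Koo intK (row i B) (a i ord0)) => //.
    by move=> y _ /=; rewrite TE.
  apply: eq_measure_integral => A mA _.
  by transitivity (s%:num%:E * lam k A)%E; rewrite // sE; exact/esym/rE.
have colE v D : \col_(i < k) (v * \int[lam k]_(y in D) (tnth y i : R)) = v *: moment D.
  by apply/colP => i; rewrite !mxE.
rewrite cE cE' !colE zE VE -addrA -mulmxA -mulmxDr; congr (_ + _ *m _).
rewrite -scalemxAr; apply: (scalerI v0); rewrite scalerDr !scalerA divff// scale1r.
rewrite addrC -momE fvE mulfK// mulrC.
Qed.

End CentroidUnique.

(** * Existence and affine equivariance of centroids *)

Section CentroidExists.
Context {R : realType} {d : nat}.
Notation RT := (measurableTypeR R).
Notation lam := lebesgue_tuple.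
Implicit Types C : set 'cV[R]_d.

(** Stated for combinations of any length, so that all vertices of an affine frame can be combined
    at once. *)
Definition convex_comb_closed C := forall m (p : 'I_m -> R) (a : 'I_m -> 'cV[R]_d),
  (forall i, 0 <= p i) -> \sum_i p i = 1 -> (forall i, C (a i)) ->
  C (\sum_i p i *: a i).

Definition coord_bounded C M := forall x i, C x -> `|x i ord0| <= M.

(** Take [k] maximal among the numbers of linearly independent edges from a point of [C] to other
    points of [C]. A point outside the resulting affine span would supply one more independent
    edge. *)
Lemma affine_frame_spans C : C !=set0 ->
  exists k z (V : 'M[R]_(d, k)), [/\ \rank V = k, C z,
    forall j, C (z + col j V) & C `<=` range (affine_param z V)].
Proof.
move=> [z0 Cz0].
pose P k := `[< exists z (V : 'M[R]_(d, k)),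
  [/\ \rank V = k, C z & forall j, C (z + col j V)] >].
have P0 : exists k, P k.
  exists 0%N; apply/asboolP; exists z0, 0; split => //; last by case.
  by rewrite mxrank0.
have Pd k : P k -> (k <= d)%N.
  by move=> /asboolP[z [V [rV _ _]]]; rewrite -rV rank_leq_row.
case: (ex_maxnP P0 Pd) => k /asboolP[z [V [rV Cz CV]]] kmax.
exists k, z, V; split => // x Cx.
have [|xV] := boolP ((x - z)^T <= V^T)%MS.
  move=> /submxP[y xzE]; exists (colt y^T) => //.
  rewrite /affine_param -/(tcol _) coltK.
  have -> : V *m y^T = x - z by apply: trmx_inj; rewrite trmx_mul trmxK -xzE.
  by rewrite addrC subrK.
suff /kmax : P (k + 1)%N by rewrite addn1 ltnn.
apply/asboolP; exists z, (row_mx V (x - z)); split => //.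
  rewrite -mxrank_tr tr_row_mx -addsmxE; apply/eqP; rewrite eqn_leq.
  apply/andP; split.
    rewrite (leq_trans (mxrank_adds_leqif _ _))// mxrank_tr rV leq_add2l.
    exact: rank_leq_row.
  rewrite addn1 -[X in (X < _)%N]rV -mxrank_tr; apply: rank_ltmx.
  by rewrite ltmxE addsmxSl addsmx_sub submx_refl.
move=> j; case: (split_ordP j) => i ->.
  by rewrite colKl.
rewrite colKr [col _ _](_ : _ = x - z) ?[z + _]addrC ?subrK//.
by apply/colP => l; rewrite mxE ord1.
Qed.

Lemma centroid_exists C M : C !=set0 -> convex_comb_closed C ->
  coord_bounded C M ->
  (forall k z (V : 'M[R]_(d, k)), measurable (affine_param z V @^-1` C)) ->
  exists c, is_centroid C c.
Proof.
move=> C0 cC bC mC.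
have [k [z [V [rV Cz CV CzV]]]] := affine_frame_spans C0.
set K := affine_param z V @^-1` C.
have mK : measurable K by exact: mC.
have [W WV] := left_inverse_full_rank rV.
(* The left inverse [W] recovers y from the point it parametrizes, so bounds on [C] give bounds on
   y; summing over all rows makes the bound independent of the coordinate. *)
pose N := \sum_i \sum_j `|W i j| * (M + `|z j ord0|).
have M0 j : 0 <= M + `|z j ord0|.
  by apply: addr_ge0 => //; apply: le_trans (bC z j Cz).
have KN y i : K y -> `|tnth y i| <= N.
  move=> Ky; have -> : tnth y i = (W *m (affine_param z V y - z)) i ord0.
    by rewrite /affine_param addrAC subrr add0r mulmxA WV mul1mx mxE.
  rewrite mxE (le_trans (ler_norm_sum _ _ _))//.
  rewrite /N (bigD1 i)//= ler_wpDr//.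
    by apply: sumr_ge0 => l _; apply: sumr_ge0 => j _; rewrite mulr_ge0.
  apply: ler_sum => j _; rewrite normrM ler_wpM2l//.
  rewrite [(_ - z) j ord0]mxE [X in _ + X]mxE.
  by rewrite (le_trans (ler_normB _ _))// lerD2r bC.
have Koo : (lam k K < +oo)%E.
  have [N0|N0] := leP 0 N.
    apply: (@le_lt_trans _ _ (lam k (box k (- N) N))).
      apply: le_measure; rewrite ?inE//; first exact: measurable_box.
      by move=> y Ky i; rewrite -ler_norml; exact: KN.
    by rewrite lebesgue_tuple_box ?ltry// ge0_cp.
  move: N0; rewrite ltNge => /negP[]; apply: sumr_ge0 => l _.
  by apply: sumr_ge0 => j _; rewrite mulr_ge0.
have K0 : (0 < lam k K)%E.
  (* With side 1/(k+1) the coordinates of a point of the cube sum to at most 1, so the cube lies in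
     the parameter simplex of the frame. *)
  apply: (@lt_le_trans _ _ (lam k (box k 0 (k.+1%:R^-1)))).
    by rewrite lebesgue_tuple_box ?invr_ge0// lte_fin exprn_gt0// subr0 invr_gt0.
  apply: le_measure; rewrite ?inE//; first exact: measurable_box.
  move=> y yb; rewrite /K /= /affine_param.
  (* Barycentric weights: index 0 stands for the base point [z] and receives what the other
     coordinates leave over. *)
  pose p (i : 'I_k.+1) : R :=
    oapp (fun j => tnth y j) (1 - \sum_j tnth y j) (unlift ord0 i).
  pose a (i : 'I_k.+1) := oapp (fun j => z + col j V) z (unlift ord0 i).
  have -> : z + V *m \col_i tnth y i = \sum_i p i *: a i.
    rewrite big_ord_recl.
    rewrite (eq_bigr (fun j => tnth y j *: z + tnth y j *: col j V)); last first.
      by move=> j _; rewrite /p /a liftK /= scalerDr.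
    rewrite /p /a unlift_none/=.
    rewrite big_split/= -scaler_suml addrA -scalerDl subrK scale1r; congr (_ + _).
    apply/colP => i; rewrite mxE summxE; apply: eq_bigr => j _.
    by rewrite !mxE mulrC.
  apply: cC.
  - move=> i; rewrite /p; case: unliftP => [j _|_] /=; first by have /andP[] := yb j.
    rewrite subr_ge0 (le_trans (ler_sum _ (fun j _ => proj2 (andP (yb j)))))//.
    rewrite sumr_const card_ord -[_ *+ _]mulr_natr ler_pdivrMl// mulr1 ler_nat.
    exact: leqnSn.
  - rewrite big_ord_recl (eq_bigr (fun j => tnth y j : R)); last first.
      by move=> j _; rewrite /p liftK.
    by rewrite /p unlift_none/= subrK.
  - by move=> i; rewrite /a; case: unliftP => [j _|_] /=.
exists (z + V *m \col_(i < k)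
  ((fine (lam k K))^-1 * \int[lam k]_(y in K) (tnth y i : R))).
exists k, z, V; split => //; first by rewrite K0.
move=> i; apply: measurable_bounded_integrable => //.
  by apply: measurable_funTS; exact: measurable_tnth.
exists N; split; first exact: num_real.
by move=> x Nx y Ky /=; rewrite (le_trans (KN y i Ky))// ltW.
Qed.

(** Composing the parametrization with the affine map leaves the parameter set unchanged, and with
    it the volume and all integrals. *)
Lemma centroid_affine C c (A : 'M[R]_d) b : A \in unitmx ->
  is_centroid C c -> is_centroid [set A *m x + b | x in C] (A *m c + b).
Proof.
move=> uA [k [z [V [rV CV mK intK ->]]]].
have KE : affine_param (A *m z + b) (A *m V) @^-1` [set A *m x + b | x in C] =
    affine_param z V @^-1` C.
  have E y : affine_param (A *m z + b) (A *m V) y = A *m affine_param z V y + b.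
    by rewrite /affine_param mulmxDr mulmxA addrAC.
  apply/seteqP; split => y /=; rewrite E; last by move=> Cy; exists (affine_param z V y).
  move=> [x Cx /addIr/(congr1 (mulmx (invmx A)))].
  by rewrite !mulmxA mulVmx// !mul1mx => <-.
exists k, (A *m z + b), (A *m V); rewrite KE; split => //.
- by rewrite -mxrank_tr trmx_mul mxrankMfree ?mxrank_tr// row_free_unit unitmx_tr.
- move=> _ [x Cx <-]; have [y _ yx] := CV x Cx; exists y => //.
  by rewrite -yx /affine_param mulmxDr mulmxA addrAC.
- by rewrite mulmxDr mulmxA addrAC.
Qed.

Lemma centroidE C c : is_centroid C c -> centroid C = c.
Proof.
by move=> cc; apply: (centroid_unique _ cc); apply: xgetPex; exists c.
Qed.

End CentroidExists.

(** * Convex hulls and exit points *)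

Section Dot.
Context {R : realType} {d : nat}.
Implicit Types u x y z : 'cV[R]_d.

Lemma dotE u x : dot u x = \sum_i u i ord0 * x i ord0.
Proof. by rewrite /dot mxE; apply: eq_bigr => i _; rewrite mxE. Qed.

Lemma dotC u x : dot u x = dot x u.
Proof. by rewrite !dotE; apply: eq_bigr => i _; rewrite mulrC. Qed.

Lemma dotDr u x y : dot u (x + y) = dot u x + dot u y.
Proof. by rewrite /dot mulmxDr mxE. Qed.

Lemma dotZr u (a : R) x : dot u (a *: x) = a * dot u x.
Proof. by rewrite /dot -scalemxAr mxE. Qed.

Lemma dotNr u x : dot u (- x) = - dot u x.
Proof. by rewrite /dot mulmxN mxE. Qed.

Lemma dotBr u x y : dot u (x - y) = dot u x - dot u y.
Proof. by rewrite dotDr dotNr. Qed.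

Lemma dotDl u x y : dot (x + y) u = dot x u + dot y u.
Proof. by rewrite dotC dotDr !(dotC u). Qed.

Lemma dotZl u (a : R) x : dot (a *: x) u = a * dot x u.
Proof. by rewrite dotC dotZr dotC. Qed.

Lemma dot0l x : dot 0 x = 0.
Proof. by rewrite /dot trmx0 mul0mx mxE. Qed.

Lemma dot_sumr u m (x : 'I_m -> 'cV[R]_d) :
  dot u (\sum_i x i) = \sum_i dot u (x i).
Proof. by rewrite /dot mulmx_sumr summxE. Qed.

Lemma dot_mulmxr u (A : 'M[R]_d) x : dot u (A *m x) = dot (A^T *m u) x.
Proof. by rewrite /dot trmx_mul trmxK mulmxA. Qed.

Lemma dot_sqrD x y (t : R) : dot (x + t *: y) (x + t *: y) =
  dot x x + t * (2 * dot x y + t * dot y y).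
Proof. by rewrite dotDr !dotDl !dotZl !dotZr (dotC y x); ring. Qed.

Lemma dot_ge0 x : 0 <= dot x x.
Proof. by rewrite dotE; apply: sumr_ge0 => i _; exact: sqr_ge0. Qed.

Lemma dot_eq0 x : (dot x x == 0) = (x == 0).
Proof.
apply/eqP/eqP => [|->]; last exact: dot0l.
rewrite dotE => /psumr_eq0P x0; apply/colP => i; rewrite mxE.
apply/eqP; rewrite -sqrf_eq0; apply/eqP.
by rewrite expr2; apply: x0 => // j _; exact: sqr_ge0.
Qed.

Lemma enorm_ge0 x : 0 <= enorm x.
Proof. exact: sqrtr_ge0. Qed.

Lemma enorm_eq0 x : (enorm x == 0) = (x == 0).
Proof. by rewrite sqrtr_eq0 le_eqVlt ltNge dot_ge0 orbF dot_eq0. Qed.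

Lemma enormZ (a : R) x : enorm (a *: x) = `|a| * enorm x.
Proof.
by rewrite /enorm dotZr dotZl mulrA -expr2 sqrtrM ?sqr_ge0// sqrtr_sqr.
Qed.

Lemma enorm_le_sum x : enorm x <= \sum_i `|x i ord0|.
Proof.
have s0 : 0 <= \sum_i `|x i ord0| by exact: sumr_ge0.
rewrite -[leRHS]ger0_norm// -sqrtr_sqr ler_wsqrtr// dotE expr2 mulr_suml.
apply: ler_sum => i _; rewrite (le_trans (ler_norm _))// normrM ler_wpM2l//.
by rewrite (bigD1 i)//= lerDl sumr_ge0.
Qed.

Lemma dot_continuous u : continuous (dot u).
Proof.
rewrite (_ : dot u = fun x => \sum_i u i ord0 * x i ord0); last first.
  by apply/funext => x; rewrite dotE.
apply: continuous_big; first exact: add_continuous.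
by move=> i _ x; exact: (cvgM (cvg_cst _) (@coord_continuous _ _ _ i ord0 x)).
Qed.

End Dot.

Section Hull.
Context {R : realType} {d n : nat}.
Variable X : 'I_n -> 'cV[R]_d.
Implicit Types u x y o : 'cV[R]_d.

Lemma data_hull_vertex i : data_hull X (X i).
Proof.
exists (fun j => (j == i)%:R); split => [j||].
- by rewrite ler0n.
- by rewrite (bigD1 i)//= eqxx big1 ?addr0// => j /negbTE ->.
- rewrite (bigD1 i)//= eqxx scale1r big1 ?addr0// => j /negbTE ->.
  by rewrite scale0r.
Qed.

Lemma data_hull_convex x y (t : R) : 0 <= t <= 1 ->
  data_hull X x -> data_hull X y -> data_hull X (x + t *: (y - x)).
Proof.
move=> /andP[t0 t1] [p [p0 p1 ->]] [q [q0 q1 ->]].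
exists (fun i => (1 - t) * p i + t * q i); split.
- by move=> i; rewrite addr_ge0// mulr_ge0// subr_ge0.
- by rewrite big_split/= -!mulr_sumr p1 q1 !mulr1 subrK.
- rewrite -sumrB scaler_sumr -big_split/=; apply: eq_bigr => i _.
  by rewrite -scalerBl scalerA -scalerDl; congr (_ *: _); ring.
Qed.

(** The weighted average of the differences dot u (X i) - dot u x is zero, so they cannot all be
    positive. *)
Lemma data_hull_halfspace_point x u : data_hull X x ->
  exists i, dot u (X i) <= dot u x.
Proof.
move=> [p [p0 p1 xE]]; apply/not_existsP => h.
have gt i : 0 < dot u (X i) - dot u x.
  by rewrite subr_gt0 ltNge; apply/negP/h.
have s0 : \sum_i p i * (dot u (X i) - dot u x) = 0.
  under eq_bigr do rewrite mulrBr; rewrite sumrB -mulr_suml p1 mul1r.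
  rewrite [in X in _ - X]xE dot_sumr.
  by under [X in _ - X]eq_bigr do rewrite dotZr; rewrite subrr.
have /psumr_eq0P pz := s0.
have p_eq0 i : p i = 0.
  have /eqP := pz (fun i _ => mulr_ge0 (p0 i) (ltW (gt i))) i isT.
  by rewrite mulf_eq0 (gt_eqF (gt i)) orbF => /eqP.
by move: p1; rewrite big1// => /eqP; rewrite eq_sym oner_eq0.
Qed.

Lemma data_hull_coord_bounded :
  coord_bounded (data_hull X) (\sum_i \sum_j `|X j i ord0|).
Proof.
move=> x i [p [p0 p1 ->]]; rewrite summxE (le_trans (ler_norm_sum _ _ _))//.
rewrite [leRHS](bigD1 i)//= ler_wpDr//.
  by apply: sumr_ge0 => l _; exact: sumr_ge0.
apply: ler_sum => j _; rewrite mxE normrM ger0_norm// ler_piMl//.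
by rewrite -p1 (bigD1 j)//= lerDl sumr_ge0.
Qed.

(** The hull is the continuous image of the compact simplex of weights. *)
Lemma data_hull_compact : compact (data_hull X).
Proof.
pose S := [set p : 'rV[R]_n | forall i, `[0, 1]%classic (p ord0 i)] `&`
  (fun p : 'rV[R]_n => \sum_i p ord0 i) @^-1` [set 1].
have cS : compact S.
  apply: compact_closedI.
    apply: (@rV_compact R n (fun=> `[0, 1]%classic)) => _.
    exact: segment_compact.
  apply: preimage_closed; last exact: closed_eq.
  move=> p _; apply: continuous_big; first exact: add_continuous.
  by move=> i _; exact: coord_continuous.
rewrite (_ : data_hull X = [set \sum_i (p : 'rV[R]_n) ord0 i *: X i | p in S]).
  apply: continuous_compact cS; apply: continuous_subspaceT.
  apply: continuous_big; first exact: add_continuous.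
  by move=> i _ p; exact: (cvgZ (@coord_continuous _ _ _ ord0 i p) (cvg_cst _)).
apply/seteqP; split => x /=.
  move=> [p [p0 p1 ->]]; exists (\row_i p i); last first.
    by apply: eq_bigr => i _; rewrite mxE.
  split => [i|] /=; last by under eq_bigr do rewrite mxE.
  rewrite /= mxE in_itv/= p0/= -p1 (bigD1 i)//= lerDl.
  exact: sumr_ge0.
move=> [p [/= p01 p1] <-]; exists (p ord0); split => // i.
by have := p01 i; rewrite in_itv/= => /andP[].
Qed.

Lemma data_hull_closed : closed (data_hull X).
Proof. by apply: compact_closed data_hull_compact; exact: norm_hausdorff. Qed.

(* The separating direction points from [x] to its nearest point in the hull. *)
Lemma data_hull_separation x : (0 < n)%N -> ~ data_hull X x ->
  exists u, forall i, dot u x < dot u (X i).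
Proof.
move=> n0 xX.
have H0 : data_hull X !=set0 by exists (X (Ordinal n0)); exact: data_hull_vertex.
have [|z /set_mem zX zmin] :=
    compact_EVT_min (f := fun y => dot (y - x) (y - x)) H0 data_hull_compact.
  apply: continuous_subspaceT.
  under eq_fun do rewrite dotE.
  apply: continuous_big; first exact: add_continuous.
  move=> i _ y.
  have c : {for y, continuous (fun y : 'cV[R]_d => (y - x) i ord0)}.
    rewrite (_ : (fun _ => _) = fun y => y i ord0 - x i ord0); last first.
      by apply/funext => z; rewrite !mxE.
    exact: (cvgB (@coord_continuous _ _ _ i ord0 y) (cvg_cst _)).
  exact: (cvgM c c).
exists (z - x) => i.
set w := z - x; have w0 : 0 < dot w w.
  rewrite lt_neqAle dot_ge0 andbT eq_sym dot_eq0 subr_eq0.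
  by apply/eqP => zx; apply: xX; rewrite -zx.
suff : dot w w <= dot w (X i - x) by move=> /(lt_le_trans w0); rewrite dotBr subr_gt0.
have -> : X i - x = w + (X i - z) by rewrite [RHS]addrC addrA subrK.
rewrite dotDr lerDl leNgt; apply/negP => neg.
set v := X i - z in neg *.
(* Minimality of the distance at z, tested along the segment from z to X i. *)
have min t : 0 <= t <= 1 -> 0 <= t * (2 * dot w v + t * dot v v).
  move=> t01; have /mem_set/zmin := data_hull_convex t01 zX (data_hull_vertex i).
  have -> : z + t *: (X i - z) - x = w + t *: v by rewrite /w addrAC.
  by rewrite dot_sqrD -/w lerDl.
have v0 : 0 <= dot v v by exact: dot_ge0.
(* This step length lies in (0, 1] and makes t |v|^2 at most -<w, v>, so the bracket in [min] is at
   most <w, v>, which is negative. *)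
pose t := (- dot w v) / (- dot w v + dot v v).
have den : 0 < - dot w v + dot v v by rewrite ltr_pwDl// oppr_gt0.
have t0 : 0 < t by rewrite divr_gt0// oppr_gt0.
have t1 : t <= 1 by rewrite ler_pdivrMr// mul1r lerDl.
have := min t; rewrite ltW//= t1 => /(_ isT); rewrite pmulr_rge0//.
apply/negP; rewrite -ltNge.
have : t * dot v v <= - dot w v.
  rewrite /t mulrAC ler_pdivrMr// ler_wpM2l// ?lerDr oppr_ge0; exact: ltW.
lra.
Qed.

Definition exit_param o x (t : R) : Prop :=
  [/\ 0 <= t, t < 1, data_hull X (o + t *: (x - o)) &
    forall s, t < s -> ~ data_hull X (o + s *: (x - o))].

(** Take the largest t in the compact set of parameters in [0, 1] whose point lies in the hull. No
    hull point has a parameter above 1, since convexity would then put x, which lies between it and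
    o, in the hull. *)
Lemma exit_param_exists o x : data_hull X o -> ~ data_hull X x ->
  exists t, exit_param o x t.
Proof.
move=> oX xX.
have cont : continuous (fun t : R => o + t *: (x - o)).
  by move=> t; exact: (cvgD (cvg_cst _) (cvgZ (@cvg_id _ _) (cvg_cst _))).
pose S := `[0, 1]%classic `&` (fun t : R => o + t *: (x - o)) @^-1` data_hull X.
have cS : compact S.
  apply: compact_closedI; first exact: segment_compact.
  by apply: preimage_closed; [move=> t _; exact: cont|exact: data_hull_closed].
have S0 : S !=set0.
  by exists 0; split; rewrite /= ?in_itv/= ?lexx ?ler01// scale0r addr0.
have [|t /set_mem[/= t01 tX] tmax] := compact_EVT_max (f := id) S0 cS.
  by apply: continuous_subspaceT => t; exact: cvg_id.
move: t01; rewrite in_itv/= => /andP[t0 t1].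
have le1 s : 0 <= s -> data_hull X (o + s *: (x - o)) -> s <= 1.
  move=> s0 sX; rewrite leNgt; apply/negP => s1; apply: xX.
  have sV : 0 <= s^-1 <= 1 by rewrite invr_ge0 s0 invf_le1 ?ltW// (lt_trans _ s1).
  have := data_hull_convex sV oX sX.
  rewrite [X in _ *: X]addrAC subrr add0r scalerA mulVf ?gt_eqF ?(lt_trans _ s1)//.
  by rewrite scale1r addrC subrK.
exists t; split => //.
  rewrite lt_neqAle t1 andbT; apply/eqP => t_eq1; apply: xX.
  by move: tX; rewrite t_eq1 scale1r addrC subrK.
move=> s ts sX; have s0 : 0 <= s by rewrite (le_trans t0)// ltW.
have : s <= t by apply: tmax; apply/mem_set; split; rewrite /= ?in_itv/= ?s0 ?le1.
by rewrite leNgt ts.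
Qed.

(** At an interior point, slightly larger parameters would still give hull points. *)
Lemma exit_param_boundary o x t : exit_param o x t ->
  boundary (data_hull X) (o + t *: (x - o)).
Proof.
move=> [t0 t1 tX tmax]; split; first exact: subset_closure.
move=> /= int.
have cont : {for t, continuous (fun t : R => o + t *: (x - o))}.
  exact: (cvgD (cvg_cst _) (cvgZ (@cvg_id _ _) (cvg_cst _))).
have /nbhs_ballP[e /= e0 be] := cont _ int.
apply: (tmax (t + e / 2)); first by rewrite ltrDl divr_gt0.
apply: be; rewrite /ball/= opprD addrA subrr add0r normrN ger0_norm ?ltr_pdivrMr//.
  by rewrite ltr_pMr// ltr1n.
by rewrite divr_ge0// ltW.
Qed.

(** The exit point is unique: the hull is closed, so every exit point lies in it, and of two
    different exit parameters the smaller would exclude the larger. The value chosen by [xget] is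
    therefore the point with parameter t. *)
Lemma outside_depthE o x t : ~ data_hull X x -> data_hull X o ->
  exit_param o x t -> outside_depth X o x = t / n%:R.
Proof.
move=> xX oX ep; have [t0 t1 tX tmax] := ep.
have -> : outside_depth X o x =
    enorm (t *: (x - o)) / enorm (x - o) * (1 / n%:R).
  rewrite /outside_depth; congr (enorm _ / _ * _).
  suff -> : exit_point (data_hull X) o x = o + t *: (x - o).
    by rewrite addrAC subrr add0r.
  have : is_exit_point (data_hull X) o x (exit_point (data_hull X) o x).
    apply: xgetPex; exists (o + t *: (x - o)), t; split => //.
    exact: exit_param_boundary.
  move=> [s [s0 -> [sX _] smax]].
  move: sX; rewrite -(closure_id _).1; last exact: data_hull_closed.
  move=> sX; have [ts|st|-> //] := ltgtP t s; first by case: (tmax s ts).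
  by case: (smax t st).
rewrite enormZ ger0_norm// mulfK ?div1r// enorm_eq0 subr_eq0.
by apply/eqP => xo; apply: xX; rewrite xo.
Qed.

End Hull.

(** * Extended depths *)

Section AffineImage.
Context {R : realType} {d n : nat}.
Variables (X : 'I_n -> 'cV[R]_d) (A : 'M[R]_d) (b : 'cV[R]_d).
Hypothesis uA : A \in unitmx.
Let Y i := A *m X i + b.

Lemma affine_comb (p : 'I_n -> R) : \sum_i p i = 1 ->
  \sum_i p i *: Y i = A *m (\sum_i p i *: X i) + b.
Proof.
move=> p1; rewrite /Y mulmx_sumr; under eq_bigr do rewrite scalerDr.
rewrite big_split/= -scaler_suml p1 scale1r; congr (_ + _).
by apply: eq_bigr => i _; rewrite scalemxAr.
Qed.

Lemma affine_inj : injective (fun x : 'cV[R]_d => A *m x + b).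
Proof.
move=> x y /addIr/(congr1 (mulmx (invmx A))).
by rewrite !mulmxA mulVmx// !mul1mx.
Qed.

Lemma data_hull_affine x : data_hull Y (A *m x + b) <-> data_hull X x.
Proof.
split=> -[p [p0 p1 E]]; exists p; split => //.
  by apply: affine_inj => /=; rewrite E affine_comb.
by rewrite E affine_comb.
Qed.

Lemma exit_param_affine c x t :
  exit_param X c x t -> exit_param Y (A *m c + b) (A *m x + b) t.
Proof.
have E s : A *m c + b + s *: (A *m x + b - (A *m c + b)) =
    A *m (c + s *: (x - c)) + b.
  by rewrite opprD addrACA subrr addr0 -mulmxBr scalemxAr mulmxDr addrAC.
move=> [t0 t1 tX tmax]; split => //; first by rewrite E data_hull_affine.
by move=> s /tmax; rewrite E data_hull_affine.
Qed.

End AffineImage.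

Section ExtendedDepth.
Context {R : realType} {d n : nat}.
Hypothesis n0 : (0 < n)%N.
Implicit Types (X : 'I_n -> 'cV[R]_d) (D : 'cV[R]_d -> R) (c x : 'cV[R]_d).

(** The common shape of [EHD] and [EZD], both of which are instances by computation; the center [c]
    and the inner depth [D] are left free. *)
Definition extended_depth X D c x : R :=
  if x \in data_hull X then D x else outside_depth X c x.

Lemma extended_depth_in X D c x : data_hull X x -> extended_depth X D c x = D x.
Proof. by move=> xX; rewrite /extended_depth mem_set. Qed.

Lemma extended_depth_out X D c x t : ~ data_hull X x -> data_hull X c ->
  exit_param X c x t -> extended_depth X D c x = t / n%:R.
Proof.
by move=> xX cX ct; rewrite /extended_depth memNset//; exact: outside_depthE.
Qed.

Lemma extended_depth_affine X D D' c (A : 'M[R]_d) b x : A \in unitmx ->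
  data_hull X c -> (data_hull X x -> D' (A *m x + b) = D x) ->
  extended_depth (fun i => A *m X i + b) D' (A *m c + b) (A *m x + b) =
  extended_depth X D c x.
Proof.
move=> uA cX DD'; have [xX|xX] := pselect (data_hull X x).
  by rewrite !extended_depth_in ?DD'// data_hull_affine.
have [t ct] := exit_param_exists cX xX.
rewrite (extended_depth_out _ xX cX ct).
rewrite (extended_depth_out _ _ _ (exit_param_affine b uA ct))//.
  by rewrite data_hull_affine.
by rewrite data_hull_affine.
Qed.

Section Properties.
Variables (X : 'I_n -> 'cV[R]_d) (D : 'cV[R]_d -> R) (c : 'cV[R]_d).
Hypothesis cX : data_hull X c.
Hypothesis D_ge : forall x, data_hull X x -> n%:R^-1 <= D x.
Hypothesis D_mono : forall x (a : R), 0 <= a <= 1 -> data_hull X x ->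
  D x <= D (c + a *: (x - c)).
Let ED := extended_depth X D c.

Lemma ray_data_hull x (a : R) : 0 <= a <= 1 -> data_hull X x ->
  data_hull X (c + a *: (x - c)).
Proof. by move=> a01 xX; exact: data_hull_convex. Qed.

(** If x is outside and its contraction inside, then t/n is below 1/n, which bounds [D] from below.
    If both are outside, the hull point with parameter t towards x has parameter t/a towards the
    contracted point, whose exit parameter s therefore satisfies t <= t/a <= s. *)
Lemma extended_depth_mono x (a : R) : 0 <= a <= 1 ->
  ED x <= ED (c + a *: (x - c)).
Proof.
move=> /andP[a0 a1]; have a01 : 0 <= a <= 1 by rewrite a0.
have [xX|xX] := pselect (data_hull X x).
  by rewrite /ED !extended_depth_in//; [exact: D_mono|exact: ray_data_hull].
have [t ct] := exit_param_exists cX xX; have [t0 t1 tX _] := ct.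
rewrite /ED (extended_depth_out D xX cX ct).
have [axX|axX] := pselect (data_hull X (c + a *: (x - c))).
  rewrite extended_depth_in// (le_trans _ (D_ge axX))//.
  by rewrite ler_piMl ?invr_ge0// ltW.
have [s cs] := exit_param_exists cX axX; have [s0 s1 _ smax] := cs.
rewrite (extended_depth_out D axX cX cs) ler_wpM2r ?invr_ge0//.
have a_gt0 : 0 < a.
  rewrite lt_neqAle a0 andbT eq_sym; apply/eqP => a_eq0.
  by apply: axX; rewrite a_eq0 scale0r addr0.
apply: (@le_trans _ _ (t / a)); first by rewrite ler_pdivlMr// ler_piMr.
rewrite leNgt; apply/negP => /smax; apply.
by rewrite addrAC subrr add0r scalerA divfK// gt_eqF.
Qed.

Lemma extended_depth_max :
  (ED c)%:E = ereal_sup [set (ED x)%:E | x in [set: 'cV[R]_d]].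
Proof.
apply/eqP; rewrite eq_le; apply/andP; split.
  by apply: ereal_sup_ubound; exists c.
apply: ge_ereal_sup => _ [x _ <-]; rewrite lee_fin.
have := @extended_depth_mono x 0; rewrite scale0r addr0; apply.
by rewrite lexx ler01.
Qed.

Lemma extended_depth_vanish (e : R) : 0 < e ->
  exists M : R, forall x : 'cV[R]_d, M < enorm x -> `|ED x| < e.
Proof.
move=> e0; pose B := \sum_i \sum_j `|X j i ord0|.
have B0 : 0 <= B by apply: sumr_ge0 => i _; exact: sumr_ge0.
(* [B] bounds the coordinates of hull points. A coordinate of x beyond [N] forces t (N - B) <= 2 B,
   so t <= e 2B / (2B + 1) < e. The summand 1 keeps this meaningful for B = 0, and the factor [d]
   below guarantees that some coordinate exceeds [N]. *)
pose N := B + (2 * B + 1) / e.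
exists (d%:R * N) => x xN.
have [i xi] : exists i, N < `|x i ord0|.
  apply/not_existsP => h; move: xN; rewrite ltNge => /negP; apply.
  rewrite (le_trans (enorm_le_sum x))//.
  rewrite (@le_trans _ _ (\sum_(i < d) N))//; last first.
    by rewrite sumr_const card_ord mulr_natl.
  by apply: ler_sum => i _; rewrite leNgt; apply/negP; exact: h.
have pos : 0 < (2 * B + 1) / e by rewrite divr_gt0// ltr_wpDl// mulr_ge0.
have xX : ~ data_hull X x.
  move=> /(data_hull_coord_bounded i); rewrite leNgt => /negP; apply.
  by rewrite (le_lt_trans _ xi)// lerDl ltW.
have [t ct] := exit_param_exists cX xX; have [t0 t1 tX _] := ct.
rewrite /ED (extended_depth_out D xX cX ct) ger0_norm ?divr_ge0//.
apply: (@le_lt_trans _ _ t).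
  by rewrite ler_pdivrMr ?ltr0n// ler_peMr// ler1n.
have cB := data_hull_coord_bounded i cX.
have tB := data_hull_coord_bounded i tX.
have : t * (N - B) <= 2 * B.
  apply: (@le_trans _ _ (t * `|x i ord0 - c i ord0|)).
    rewrite ler_wpM2l// (le_trans _ (lerB_dist _ _))// lerB//; exact: ltW.
  rewrite -[t in X in X <= _](ger0_norm t0) -normrM.
  have -> : t * (x i ord0 - c i ord0) = (c + t *: (x - c)) i ord0 - c i ord0.
    by rewrite !mxE addrAC subrr add0r.
  by rewrite (le_trans (ler_normB _ _))// mulr_natl mulr2n lerD.
rewrite /N addrAC subrr add0r mulrA ler_pdivrMr// => tle.
rewrite -(@ltr_pM2r _ (2 * B + 1)); last by rewrite ltr_wpDl// mulr_ge0.
rewrite (le_lt_trans tle)// mulrC ltr_pM2l// ltrDl//.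
Qed.

End Properties.
End ExtendedDepth.

(** * The zonoid depth *)

Section ZonoidDepth.
Context {R : realType} {d n : nat}.
Hypothesis n0 : (0 < n)%N.
Implicit Types (X : 'I_n -> 'cV[R]_d) (x : 'cV[R]_d).

Definition zonoid_levels X x : set R := [set alpha : R | 0 < alpha /\
  exists p : 'I_n -> R, [/\ x = \sum_i p i *: X i, \sum_i p i = 1
        & forall i, 0 <= n%:R * p i <= 1 / alpha]].

Let nR : 0 < n%:R :> R. Proof. by rewrite ltr0n. Qed.

Lemma ZDE X x : data_hull X x -> ZD X x = sup (zonoid_levels X x).
Proof. by move=> xX; rewrite /ZD mem_set. Qed.

(** Summing the constraints n p_i <= 1/a over i gives n <= n/a. *)
Lemma zonoid_levels_le1 X x a : zonoid_levels X x a -> a <= 1.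
Proof.
move=> [a0 [p [_ p1 pa]]].
have : \sum_i n%:R * p i <= \sum_(i < n) 1 / a.
  by apply: ler_sum => i _; have /andP[] := pa i.
rewrite -mulr_sumr p1 mulr1 sumr_const card_ord div1r -[leRHS]mulr_natl.
by rewrite ler_pMr// invf_ge1.
Qed.

Lemma zonoid_levels_invn X x : data_hull X x -> zonoid_levels X x n%:R^-1.
Proof.
move=> [p [p0 p1 xE]]; split; first by rewrite invr_gt0.
exists p; split => // i; rewrite div1r invrK mulr_ge0//= ler_piMr//.
by rewrite -p1 (bigD1 i)//= lerDl sumr_ge0.
Qed.

Lemma zonoid_levels_has_sup X x : data_hull X x -> has_sup (zonoid_levels X x).
Proof.
move=> xX; split; first by exists n%:R^-1; exact: zonoid_levels_invn.
by exists 1 => a; exact: zonoid_levels_le1.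
Qed.

Lemma ZD_ge_invn X x : data_hull X x -> n%:R^-1 <= ZD X x.
Proof.
move=> xX; rewrite ZDE//; apply: sup_upper_bound (zonoid_levels_invn xX).
exact: zonoid_levels_has_sup.
Qed.

Lemma data_meanE X : data_mean X = \sum_i n%:R^-1 *: X i.
Proof. by rewrite /data_mean scaler_sumr. Qed.

Lemma sum_invn : \sum_(i < n) n%:R^-1 = 1 :> R.
Proof. by rewrite sumr_const card_ord -[LHS]mulr_natr mulVf ?gt_eqF. Qed.

Lemma data_hull_mean X : data_hull X (data_mean X).
Proof.
exists (fun=> n%:R^-1); split; [|exact: sum_invn|exact: data_meanE].
by move=> i; rewrite invr_ge0 ltW.
Qed.

(** Every level r of x is a level of the contracted point: mix the weights of x with the uniform
    weights of the mean, which satisfy the constraint because r <= 1. *)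
Lemma ZD_mono X x (a : R) : 0 <= a <= 1 -> data_hull X x ->
  ZD X x <= ZD X (data_mean X + a *: (x - data_mean X)).
Proof.
move=> a01 xX; have yX := data_hull_convex a01 (data_hull_mean X) xX.
move/andP: (a01) => [a0 a1].
rewrite !ZDE//; apply: sup_le_ub; first by have [] := zonoid_levels_has_sup xX.
move=> r /[dup] /zonoid_levels_le1 r1 [r0 [p [xE p1 pr]]].
apply: sup_upper_bound; first exact: zonoid_levels_has_sup.
split => //; exists (fun i => (1 - a) * n%:R^-1 + a * p i); split.
- rewrite xE data_meanE -sumrB scaler_sumr -big_split/=; apply: eq_bigr => i _.
  by rewrite -scalerBl scalerA -scalerDl; congr (_ *: _); ring.
- by rewrite big_split/= -!mulr_sumr p1 sum_invn !mulr1 subrK.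
- move=> i; have /andP[pi0 pir] := pr i.
  have -> : n%:R * ((1 - a) * n%:R^-1 + a * p i) = (1 - a) + a * (n%:R * p i).
    by rewrite mulrDr mulrCA divff ?gt_eqF// mulr1 mulrCA.
  have p0 : 0 <= p i by rewrite -(pmulr_rge0 _ nR).
  rewrite addr_ge0 ?mulr_ge0 ?subr_ge0 ?(ltW nR)//=.
  have r1' : 1 <= 1 / r by rewrite div1r invf_ge1.
  apply: (@le_trans _ _ ((1 - a) * (1 / r) + a * (1 / r))).
    by rewrite lerD// ?ler_wpM2l// ler_peMr// subr_ge0.
  by rewrite -mulrDl subrK mul1r.
Qed.

Lemma ZD_affine X (A : 'M[R]_d) b x : A \in unitmx -> data_hull X x ->
  ZD (fun i => A *m X i + b) (A *m x + b) = ZD X x.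
Proof.
move=> uA xX; rewrite !ZDE ?data_hull_affine//; congr sup.
apply/seteqP; split => a [a0 [p [xE p1 pa]]]; split => //; exists p; split => //.
  by apply: (affine_inj (b := b) uA) => /=; rewrite xE affine_comb.
by rewrite xE affine_comb.
Qed.

Lemma data_mean_affine X (A : 'M[R]_d) b :
  data_mean (fun i => A *m X i + b) = A *m data_mean X + b.
Proof. by rewrite !data_meanE affine_comb// sum_invn. Qed.

Lemma EZD_statistical_depth X : statistical_depth_function EZD data_mean X.
Proof.
have E Y : EZD Y = extended_depth Y (ZD Y) (data_mean Y) by [].
have cX := data_hull_mean X.
split.
- move=> A b x uA; rewrite !E data_mean_affine.
  by apply: extended_depth_affine => // xX; exact: ZD_affine.
- rewrite /maximality_at_center E; apply: extended_depth_max => //.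
  + by move=> x; exact: ZD_ge_invn.
  + by move=> x a; exact: ZD_mono.
- move=> x a a01; rewrite E; apply: extended_depth_mono => //.
  + by move=> y; exact: ZD_ge_invn.
  + by move=> y r; exact: ZD_mono.
- by move=> e e0; rewrite E; exact: extended_depth_vanish.
Qed.

End ZonoidDepth.

(** * The halfspace median *)

Section HalfspaceDepth.
Context {R : realType} {d n : nat}.
Hypotheses (d0 : (0 < d)%N) (n0 : (0 < n)%N).
Implicit Types (X : 'I_n -> 'cV[R]_d) (u v x y : 'cV[R]_d).

(** Allowing all vectors u instead of unit ones frees later arguments from normalization; u = 0 is
    harmless because it counts all n points. *)
Definition halfspace_count X u x : nat := #|[pred i | dot u (X i) <= dot u x]|.

Let nR : 0 < n%:R :> R. Proof. by rewrite ltr0n. Qed.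

Lemma empirical_halfspace X u x :
  empirical X [set y | dot u y <= dot u x] = (halfspace_count X u x)%:R / n%:R.
Proof.
rewrite /empirical; congr (_%:R / _); apply: eq_card => i; rewrite !inE.
by apply/idP/idP => [/set_mem|? ]; [|apply/mem_set].
Qed.

Lemma halfspace_countZ X (a : R) u x : 0 < a ->
  halfspace_count X (a *: u) x = halfspace_count X u x.
Proof.
by move=> a0; apply: eq_card => i; rewrite !inE !dotZl ler_pM2l.
Qed.

Lemma halfspace_count_mono X u x y : dot u x <= dot u y ->
  (halfspace_count X u x <= halfspace_count X u y)%N.
Proof.
move=> xy; apply: subset_leq_card; apply/fintype.subsetP => i.
by rewrite !inE => /le_trans; apply.
Qed.

Lemma halfspace_count_le X u x : (halfspace_count X u x <= n)%N.
Proof. by rewrite -[leqRHS]card_ord max_card. Qed.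

Lemma halfspace_count0 X x : halfspace_count X 0 x = n.
Proof.
by rewrite -[RHS]card_ord; apply: eq_card => i; rewrite !inE !dot0l lexx.
Qed.

(** Counts are natural numbers, so a least one exists over nonzero directions, and rescaling such a
    direction to norm 1 does not change its count. Since d > 0, the all-ones vector is a nonzero
    direction to start from. *)
Lemma HD_attained X x : exists u,
  [/\ u != 0, HD X x = (halfspace_count X u x)%:R / n%:R &
      forall v, (halfspace_count X u x <= halfspace_count X v x)%N].
Proof.
pose P m := `[< exists2 u, u != 0 & halfspace_count X u x = m >].
have P0 : exists m, P m.
  exists (halfspace_count X (const_mx 1) x); apply/asboolP; exists (const_mx 1) => //.
  apply/eqP => /colP/(_ (Ordinal d0)); rewrite !mxE => /eqP.
  by rewrite oner_eq0.
case: (ex_minnP P0) => _ /asboolP[u u0 <-] umin; exists u; split => //; last first.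
  move=> v; have [->|v0] := eqVneq v 0.
    by rewrite halfspace_count0 halfspace_count_le.
  by apply: umin; apply/asboolP; exists v.
apply/eqP; rewrite eq_le; apply/andP; split.
  apply: ge_inf.
    by exists 0 => _ [v _ <-]; rewrite empirical_halfspace divr_ge0.
  have nu : 0 < enorm u by rewrite lt_neqAle enorm_ge0 andbT eq_sym enorm_eq0.
  exists ((enorm u)^-1 *: u); last first.
    by rewrite empirical_halfspace halfspace_countZ ?invr_gt0.
  by rewrite /unit_sphere/= enormZ ger0_norm ?invr_ge0 ?mulVf ?gt_eqF// ltW.
apply: lb_le_inf.
  have ne : 0 < enorm u by rewrite lt_neqAle enorm_ge0 andbT eq_sym enorm_eq0.
  eexists; exists ((enorm u)^-1 *: u) => //.
  by rewrite /unit_sphere/= enormZ ger0_norm ?invr_ge0 ?mulVf ?gt_eqF// ltW.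
move=> _ [v v1 <-]; rewrite empirical_halfspace ler_pM2r ?invr_gt0// ler_nat.
apply: umin; apply/asboolP; exists v => //.
by rewrite -enorm_eq0 (_ : enorm v = 1) ?oner_eq0.
Qed.

Lemma le_HD X x m : ((m%:R / n%:R <= HD X x) <->
  (forall u, u != 0 -> (m <= halfspace_count X u x)%N)).
Proof.
have [u [u0 -> umin]] := HD_attained X x.
rewrite ler_pM2r ?invr_gt0// ler_nat; split=> [mu v _|]; last exact.
exact: leq_trans mu (umin v).
Qed.

Lemma HD_le X x u : u != 0 -> HD X x <= (halfspace_count X u x)%:R / n%:R.
Proof.
move=> u0; have [v [v0 -> vmin]] := HD_attained X x.
by rewrite ler_pM2r ?invr_gt0// ler_nat.
Qed.

Lemma HD_ge_invn X x : data_hull X x -> n%:R^-1 <= HD X x.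
Proof.
move=> xX; rewrite -div1r -[1]/(1%:R); apply/le_HD => u _.
have [i ix] := data_hull_halfspace_point u xX.
by apply/card_gt0P; exists i.
Qed.

(** A direction separating x from the data has count 0. *)
Lemma HD_gt0_hull X x : 0 < HD X x -> data_hull X x.
Proof.
move=> hx; apply: contrapT => xX; have [u ux] := data_hull_separation n0 xX.
have u0 : u != 0.
  by apply/eqP => u0; have := ux (Ordinal n0); rewrite u0 !dot0l ltxx.
have := HD_le X x u0; rewrite /halfspace_count eq_card0 ?mul0r ?leNgt ?hx//.
by move=> i; rewrite !inE leNgt ux.
Qed.

(** Some [a j] is no higher in direction [u] than the combination, and counts grow with height. This
    makes the median region convex. *)
Lemma halfspace_count_convex X u m (J : nat) (p : 'I_J -> R)
    (a : 'I_J -> 'cV[R]_d) :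
  (forall j, 0 <= p j) -> \sum_j p j = 1 ->
  (forall j, (m <= halfspace_count X u (a j))%N) ->
  (m <= halfspace_count X u (\sum_j p j *: a j))%N.
Proof.
move=> p0 p1 ma.
have [j aj] : exists j, dot u (a j) <= dot u (\sum_j p j *: a j).
  by apply: data_hull_halfspace_point; exists p.
exact: leq_trans (ma j) (halfspace_count_mono _ aj).
Qed.

(** Depths are multiples of 1/n between 0 and 1, so a maximal depth m/n is attained; m is positive
    because data points have depth at least 1/n. *)
Lemma median_regionE X : exists2 m, (0 < m)%N &
  [/\ (forall x, halfspace_median_region X x <->
        (forall u, (m <= halfspace_count X u x)%N)),
      halfspace_median_region X !=set0 &
      forall x, halfspace_median_region X x -> HD X x = m%:R / n%:R].
Proof.
pose P m := `[< exists x, HD X x = m%:R / n%:R >].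
have P0 : exists m, P m.
  have [u [_ E _]] := HD_attained X 0.
  by exists (halfspace_count X u 0); apply/asboolP; exists 0.
have Pn m : P m -> (m <= n)%N.
  move=> /asboolP[x]; have [u [_ -> _]] := HD_attained X x.
  move=> /(mulIf (invr_neq0 (lt0r_neq0 nR)))/eqP; rewrite eqr_nat => /eqP <-.
  exact: halfspace_count_le.
case: (ex_maxnP P0 Pn) => m Pm mmax.
have mn := Pn _ Pm; move/asboolP: Pm => [x0 x0E].
have HDm y : HD X y <= m%:R / n%:R.
  have [u [_ E _]] := HD_attained X y; rewrite E ler_pM2r ?invr_gt0// ler_nat.
  by apply: mmax; apply/asboolP; exists y.
have x0r : halfspace_median_region X x0 by move=> y; rewrite x0E.
exists m.
  have := HD_ge_invn (data_hull_vertex X (Ordinal n0)).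
  move=> /le_trans/(_ (HDm _)); rewrite ler_pdivlMr// mulVf ?gt_eqF//.
  by rewrite ler1n.
split; [|by exists x0|].
  move=> x; split => [xr u|xm y].
    have [->|u0] := eqVneq u 0; first by rewrite halfspace_count0.
    by apply: (le_HD X x m).1 => //; rewrite -x0E; exact: xr.
  by apply: le_trans (HDm y) _; apply/le_HD => u _; exact: xm.
by move=> x xr; apply/eqP; rewrite eq_le HDm -x0E xr.
Qed.

(* The strict inequalities [dot u x < dot u (X i)] are open in [u]. *)
Lemma halfspace_count_rat X u x : exists q : 'cV[rat]_d,
  (halfspace_count X (map_mx ratr q) x <= halfspace_count X u x)%N.
Proof.
have : \forall v \near u, forall i, dot u x < dot u (X i) -> 0 < dot v (X i - x).
  apply: (@filter_forall _ _
    (fun i v => dot u x < dot u (X i) -> 0 < dot v (X i - x)) _ (nbhs_filter u)).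
  move=> i; have [ui|ui] := ltP (dot u x) (dot u (X i)); last first.
    by near=> v.
  have := @dot_continuous R d (X i - x) u.
  move=> /cvgr_gt/(_ 0); rewrite dotC dotBr subr_gt0 => /(_ ui).
  by apply: filterS => v + _; rewrite dotC.
move=> /nbhs_ballP[e /= e0 eu].
have /choice[q qu] : forall i, exists q : rat,
    ratr q \in `](u i ord0 - e), (u i ord0 + e)[.
  by move=> i; apply: rat_in_itvoo; rewrite ltrD2l gt0_cp.
exists (\col_i q i); apply: subset_leq_card; apply/fintype.subsetP => i.
rewrite !inE; apply: contraTT; rewrite -!ltNge => ui.
rewrite -subr_gt0 -dotBr; apply: (eu _ _ i) => //.
split => // j k; rewrite !mxE ord1 /ball/= ltr_distlC.
by have := qu j; rewrite in_itv.
Unshelve. all: by end_near. Qed.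

(** For one direction the set is a finite union, over index sets [J] with at least [m] elements, of
    finite intersections of closed halfspaces. By [halfspace_count_rat] the countably many rational
    directions impose all the conditions. *)
Lemma measurable_count_level X (m k : nat) z (V : 'M[R]_(d, k)) :
  measurable (affine_param z V @^-1`
    [set x | forall u, (m <= halfspace_count X u x)%N]).
Proof.
pose F (u : 'cV[R]_d) := [set y : k.-tuple (measurableTypeR R) |
  (m <= halfspace_count X u (affine_param z V y))%N].
have mF u : measurable (F u).
  rewrite (_ : F u = \bigcup_(J in [set J : {set 'I_n} | (m <= #|J|)%N])
    \bigcap_(i in [set` J]) [set y : k.-tuple (measurableTypeR R) |
      dot u (X i) <= dot u (affine_param z V y)]).
    apply: fin_bigcup_measurable; first exact: finite_finset.
    move=> J _; apply: fin_bigcap_measurable; first exact: finite_finset.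
    move=> i _; rewrite -[X in measurable X]setTI.
    have mf : measurable_fun setT (fun y : k.-tuple (measurableTypeR R) =>
        dot u (affine_param z V y) : measurableTypeR R).
      have E (y : k.-tuple (measurableTypeR R)) :
          dot u (affine_param z V y) =
          dot u z + ((u^T *m V) *m tcol y) ord0 ord0.
        by rewrite /affine_param dotDr /dot mulmxA.
      under eq_fun do rewrite E.
      apply: measurable_funD; first exact: measurable_cst.
      exact: (@measurable_tcol_mul _ _ _ _ _ _ id).
    have -> : [set y : k.-tuple (measurableTypeR R) |
        dot u (X i) <= dot u (affine_param z V y)] =
        (fun y : k.-tuple (measurableTypeR R) => dot u (affine_param z V y)) @^-1`
          `[dot u (X i), +oo[%classic.
      by apply/seteqP; split => y /=; rewrite in_itv/= andbT.
    by apply: mf => //; exact: measurable_itv.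
  apply/seteqP; split => y /=.
    move=> my; exists [set i | dot u (X i) <= dot u (affine_param z V y)]%SET => /=.
      by rewrite cardsE.
    by move=> i /=; rewrite inE.
  move=> [J /= mJ Jy]; apply: leq_trans mJ _.
  by apply: subset_leq_card; apply/fintype.subsetP => i iJ; rewrite inE; exact: Jy.
rewrite (_ : _ @^-1` _ = ~` \bigcup_(q in [set: 'cV[rat]_d]) ~` F (map_mx ratr q)).
  apply: measurableC; apply: countable_bigcupT_measurable => [|q]; first exact: countableP.
  exact: measurableC.
rewrite setC_bigcup; apply/seteqP; split => y /=.
  by move=> h q _; rewrite setCK; exact: h.
move=> h u; have [q qu] := halfspace_count_rat X u (affine_param z V y).
by apply: leq_trans qu; have := h q I; rewrite setCK.
Qed.

Lemma halfspace_median_centroid X :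
  is_centroid (halfspace_median_region X) (halfspace_median X).
Proof.
have [m m0 [rE r0 HDr]] := median_regionE X.
have [|||c cr] := @centroid_exists R d (halfspace_median_region X)
    (\sum_i \sum_j `|X j i ord0|) r0.
- move=> J p a p0 p1 ar; apply/rE; move=> u.
  by apply: halfspace_count_convex => // j; exact: (rE _).1 (ar j) u.
- move=> x i xr; apply: data_hull_coord_bounded; apply: HD_gt0_hull.
  by rewrite HDr// divr_gt0// ltr0n.
- move=> k z V; rewrite (_ : halfspace_median_region X =
    [set x | forall u, (m <= halfspace_count X u x)%N]).
    exact: measurable_count_level.
  by apply/seteqP; split => x /rE.
by rewrite /halfspace_median (centroidE cr).
Qed.

(** Suppose the count at c in direction u is below m. Let X j be the lowest data point strictly
    above c. A region point lower than X j would count only data points not above c, fewer than m;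
    so the whole region is at least as high as X j, and by [centroid_halfspace] so is c, a
    contradiction. *)
Lemma halfspace_median_in_region X :
  halfspace_median_region X (halfspace_median X).
Proof.
have [m m0 [rE r0 HDr]] := median_regionE X; apply/rE => u.
have cc := halfspace_median_centroid X; set c := halfspace_median X in cc *.
rewrite leqNgt; apply/negP => cm.
have mn : (m <= n)%N.
  by have [x /rE/(_ 0)] := r0; rewrite halfspace_count0.
have [i0 i0c] : exists i, dot u c < dot u (X i).
  apply/not_existsP => h; move: cm; rewrite ltnNge => /negP; apply.
  apply: leq_trans mn _; rewrite -[leqLHS]card_ord; apply: subset_leq_card.
  by apply/fintype.subsetP => i _; rewrite inE leNgt; apply/negP/h.
case: (@arg_minP _ _ _ i0 (fun i => dot u c < dot u (X i))
  (fun i => dot u (X i)) i0c) => j jc jmin.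
suff : dot u (X j) <= dot u c by rewrite leNgt jc.
apply: (centroid_halfspace cc) => x /rE/(_ u) mx.
rewrite leNgt; apply/negP => xj; move: mx; rewrite leqNgt => /negP; apply.
apply: leq_ltn_trans cm; apply: subset_leq_card; apply/fintype.subsetP => i.
rewrite !inE => ix; rewrite leNgt; apply/negP => /jmin.
by rewrite leNgt (le_lt_trans ix xj).
Qed.

Lemma halfspace_median_hull X : data_hull X (halfspace_median X).
Proof.
have [m m0 [rE r0 HDr]] := median_regionE X; apply: HD_gt0_hull.
by rewrite HDr ?divr_gt0 ?ltr0n//; exact: halfspace_median_in_region.
Qed.

(** * Affine equivariance of the halfspace median *)

Section Affine.
Variables (X : 'I_n -> 'cV[R]_d) (A : 'M[R]_d) (b : 'cV[R]_d).
Hypothesis uA : A \in unitmx.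
Let Y i := A *m X i + b.

Lemma halfspace_count_affine u x :
  halfspace_count Y u (A *m x + b) = halfspace_count X (A^T *m u) x.
Proof.
by apply: eq_card => i; rewrite !inE !dotDr lerD2r !dot_mulmxr.
Qed.

(** Directions for the transformed data correspond to directions for [X] through the transpose of
    [A], a bijection of the nonzero vectors. *)
Lemma HD_affine x : HD Y (A *m x + b) = HD X x.
Proof.
have uAT : A^T \in unitmx by rewrite unitmx_tr.
apply/eqP; rewrite eq_le; apply/andP; split.
  have [u [u0 -> _]] := HD_attained X x.
  have -> : u = A^T *m (invmx A^T *m u) by rewrite mulmxA mulmxV// mul1mx.
  rewrite -halfspace_count_affine; apply: HD_le.
  by apply: contra u0 => /eqP E; rewrite -[u]mul1mx -(mulmxV uAT) -mulmxA E mulmx0.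
have [u [u0 -> _]] := HD_attained Y (A *m x + b).
rewrite halfspace_count_affine; apply: HD_le.
by apply: contra u0 => /eqP E; rewrite -[u]mul1mx -(mulVmx uAT) -mulmxA E mulmx0.
Qed.

Lemma halfspace_median_affine :
  halfspace_median Y = A *m halfspace_median X + b.
Proof.
have E y : y = A *m (invmx A *m (y - b)) + b by rewrite mulmxA mulmxV// mul1mx subrK.
apply: centroidE.
rewrite (_ : halfspace_median_region Y =
    [set A *m x + b | x in halfspace_median_region X]).
  by apply: centroid_affine => //; exact: halfspace_median_centroid.
apply/seteqP; split => [y yr|_ [x xr <-] z].
  exists (invmx A *m (y - b)); last by rewrite -E.
  by move=> z; rewrite -HD_affine -[leRHS]HD_affine -E; exact: yr.
by rewrite [z]E !HD_affine; exact: xr.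
Qed.

End Affine.

(** In every direction the point between c and x is at least as high as the lower of the two, and
    both have counts at least that given by the depth of x. *)
Lemma HD_mono X x (a : R) : 0 <= a <= 1 ->
  HD X x <= HD X (halfspace_median X + a *: (x - halfspace_median X)).
Proof.
move=> /andP[a0 a1]; set c := halfspace_median X.
have cr : HD X x <= HD X c by exact: halfspace_median_in_region.
have [u0 [_ E _]] := HD_attained X x; rewrite E.
apply/le_HD => u uN0.
have xm : (halfspace_count X u0 x <= halfspace_count X u x)%N.
  by apply: (le_HD X x _).1 => //; rewrite E.
have cm : (halfspace_count X u0 x <= halfspace_count X u c)%N.
  by apply: (le_HD X c _).1 => //; rewrite -E.
have [cx|xc] := leP (dot u c) (dot u x).
  apply: leq_trans cm (halfspace_count_mono _ _).
  by rewrite dotDr dotZr dotBr lerDl mulr_ge0// subr_ge0.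
apply: leq_trans xm (halfspace_count_mono _ _).
rewrite dotDr dotZr dotBr -subr_ge0.
have -> : dot u c + a * (dot u x - dot u c) - dot u x =
  (1 - a) * (dot u c - dot u x) by ring.
by rewrite mulr_ge0// subr_ge0// ltW.
Qed.

Lemma EHD_statistical_depth X : statistical_depth_function EHD halfspace_median X.
Proof.
have E Y : EHD Y = extended_depth Y (HD Y) (halfspace_median Y) by [].
have cX := halfspace_median_hull X.
split.
- move=> A b x uA; rewrite !E halfspace_median_affine//.
  by apply: extended_depth_affine => // _; exact: HD_affine.
- rewrite /maximality_at_center E; apply: extended_depth_max => //.
  + by move=> x; exact: HD_ge_invn.
  + by move=> x a a01 _; exact: HD_mono.
- move=> x a a01; rewrite E; apply: extended_depth_mono => //.
  + by move=> y; exact: HD_ge_invn.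
  + by move=> y r r01 _; exact: HD_mono.
- by move=> e e0; rewrite E; exact: extended_depth_vanish.
Qed.

End HalfspaceDepth.

Theorem theorem3 (R : realType) (d n : nat) (hd : (1 <= d)%N) (hn : (1 <= n)%N)
    (X : 'I_n -> 'cV[R]_d) (hX : general_position X) :
  statistical_depth_function EHD halfspace_median X /\
  statistical_depth_function EZD data_mean X.
Proof.
split; [exact: EHD_statistical_depth|exact: EZD_statistical_depth].
Qed.
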